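(* Let $X$ be a complex Banach space that is both uniformly convex and uniformly smooth. Then the pair $(c_0(X),c_0(X))$ has the Bishop-Phelps-Bollobás property for bilinear forms. That is, for each $\varepsilon>0$ there exists $\eta(\varepsilon)>0$ such that whenever $T\in S_{\mathcal{L}^2(c_0(X)\times c_0(X))}$ and $(x_0,y_0)\in S_{c_0(X)}\times S_{c_0(X)}$ satisfy $|T(x_0,y_0)|>1-\eta(\varepsilon)$, there exist $S\in S_{\mathcal{L}^2(c_0(X)\times c_0(X))}$ and $(u_0,v_0)\in S_{c_0(X)}\times S_{c_0(X)}$ with $$|S(u_0,v_0)|=1,\quad \|u_0-x_0\|<\varepsilon,\quad\|v_0-y_0\|<\varepsilon\quad\text{and}\quad\|S-T\|<\varepsilon.$$
   Context: For a Banach space $Z$, $S_Z$ denotes its unit sphere. $c_0(X)=\bigl[\oplus_{i=1}^\infty X\bigr]_{c_0}$ is the space of sequences $x=(x(i))_{i\in\mathbb{N}}$ in $X$ with $\|x(i)\|\to 0$, normed by $\|x\|=\sup_i\|x(i)\|$. For Banach spaces $Z,W$ over $\mathbb{C}$, $\mathcal{L}^2(Z\times W)$ is the Banach space of bounded bilinear forms $T\colon Z\times W\to\mathbb{C}$ with norm $\|T\|=\sup\{|T(z,w)|:\|z\|\le 1,\|w\|\le 1\}$. Uniform convexity and uniform smoothness have their standard meanings. *)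

(* Defs.v *)
From HB Require Import structures.
From mathcomp Require Import all_boot all_order all_algebra.
From mathcomp Require Import complex.
From mathcomp Require Import all_classical all_reals all_analysis.

Set Implicit Arguments.
Unset Strict Implicit.
Unset Printing Implicit Defensive.

Import Order.TTheory GRing.Theory Num.Theory.
Import numFieldNormedType.Exports.

Local Open Scope classical_set_scope.
Local Open Scope ring_scope.
Local Open Scope complex_scope.

(* The norm of a [normedModType R[i]] is [R[i]]-valued, although all its values
   are nonnegative reals; suprema of norms are therefore taken in [R] after
   [complex.Re] and embedded back with [_%:C]. *)
Section supnorm.
Context (R : realType) (I : Type) (V : normedModType R[i]).
Implicit Types (A : set I) (f g : I -> V).

Definition supnorm A f : R := sup [set complex.Re `|f i| | i in A].

Definition bounded_norm_on A f := exists M : R, forall i, A i -> `|f i| <= M%:C.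

Lemma Re_norm (W : normedZmodType R[i]) (v : W) : (complex.Re `|v|)%:C = `|v|.
Proof.
have := normr_ge0 v; case: (`|v|) => a b.
by rewrite lecE /= => /andP[/eqP-> _].
Qed.

Let realcD (a b : R) : (a + b)%:C = a%:C + b%:C.
Proof. exact: rmorphD. Qed.

Let realcM (a b : R) : (a * b)%:C = a%:C * b%:C.
Proof. exact: rmorphM. Qed.

Let realcV (a : R) : (a^-1)%:C = a%:C^-1.
Proof. exact: fmorphV. Qed.

Lemma le_supnorm A f i :
  bounded_norm_on A f -> A i -> `|f i| <= (supnorm A f)%:C.
Proof.
move=> [M fM] Ai; rewrite -Re_norm lecR; apply: ub_le_sup; last by exists i.
by exists M => _ [j Aj <-]; rewrite -lecR Re_norm; exact: fM.
Qed.

Lemma supnorm_le A f (M : R) : A !=set0 ->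
  (forall i, A i -> `|f i| <= M%:C) -> supnorm A f <= M.
Proof.
move=> [i Ai] fM; apply: ge_sup; first by exists (complex.Re `|f i|), i.
by move=> _ [j Aj <-]; rewrite -lecR Re_norm; exact: fM.
Qed.

Lemma bounded_norm_onD A f g : bounded_norm_on A f -> bounded_norm_on A g ->
  bounded_norm_on A (f \+ g).
Proof.
move=> [M fM] [N gN]; exists (M + N) => i Ai.
rewrite realcD; apply: (le_trans (ler_normD _ _)).
by apply: lerD; [exact: fM|exact: gN].
Qed.

Lemma bounded_norm_onZ A (a : R[i]) f : bounded_norm_on A f ->
  bounded_norm_on A (a \*: f).
Proof.
move=> [M fM]; exists (complex.Re `|a| * M) => i Ai.
by rewrite normrZ realcM Re_norm ler_wpM2l// fM.
Qed.

Lemma ler_supnormD A f g : A !=set0 ->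
  bounded_norm_on A f -> bounded_norm_on A g ->
  supnorm A (f \+ g) <= supnorm A f + supnorm A g.
Proof.
move=> A0 bf bg; apply: supnorm_le => // i Ai.
rewrite realcD; apply: (le_trans (ler_normD _ _)).
by apply: lerD; exact: le_supnorm.
Qed.

Lemma supnormZ A (a : R[i]) f : A !=set0 -> bounded_norm_on A f ->
  (supnorm A (a \*: f))%:C = `|a| * (supnorm A f)%:C.
Proof.
move=> A0 bf; have [->|a0] := eqVneq a 0.
  rewrite normr0 mul0r; congr (_%:C); apply/le_anti/andP; split.
    by apply: supnorm_le => // i Ai /=; rewrite scale0r normr0.
  case: (A0) => i Ai; rewrite -lecR; apply: le_trans (le_supnorm _ Ai) => //.
  exact: bounded_norm_onZ.
rewrite -(Re_norm a) -realcM; congr (_%:C); apply/le_anti/andP; split.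
  apply: supnorm_le => // i Ai.
  by rewrite normrZ realcM Re_norm ler_wpM2l// le_supnorm.
have a_gt0 : 0 < complex.Re `|a| by rewrite -ltcR Re_norm normr_gt0.
rewrite -ler_pdivlMl//; apply: supnorm_le => // i Ai.
rewrite realcM realcV Re_norm ler_pdivlMl ?normr_gt0// -normrZ.
by apply: (@le_supnorm A (a \*: f)) => //; exact: bounded_norm_onZ.
Qed.

Lemma supnorm_eq0 A f i : bounded_norm_on A f -> (supnorm A f)%:C = 0 ->
  A i -> f i = 0.
Proof.
move=> bf f0 Ai; apply/normr0_eq0/le_anti/andP; split => //.
by rewrite -f0 le_supnorm.
Qed.

End supnorm.

Section c0_space.
Context (R : realType) (X : normedModType R[i]).

(* Convergence to [0] for the norm topology of [X], i.e. `|x i| tends to [0]. *)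
Definition null_seq : {pred nat -> X} :=
  fun x => `[< x i @[i --> \oo] --> (0 : X) >].

Lemma null_seq_submod_closed : submod_closed null_seq.
Proof.
split=> [|a x y /asboolP x0 /asboolP y0]; apply/asboolP; first exact: cvg_cst.
rewrite -[0 : X]addr0 -[X in nbhs (X + _)](scaler0 _ a).
by apply: cvgD => //; exact: cvgZl_tmp.
Qed.

HB.instance Definition _ :=
  GRing.isSubmodClosed.Build _ _ null_seq null_seq_submod_closed.

Record c0 := C0 { c0_seq :> nat -> X ; _ : c0_seq \in null_seq }.

HB.instance Definition _ := [isSub for c0_seq].
HB.instance Definition _ := [Choice of c0 by <:].
HB.instance Definition _ := [SubChoice_isSubLmodule of c0 by <:].

Lemma c0_cvg (x : c0) : x i @[i --> \oo] --> (0 : X).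
Proof. by case: x => x /= /asboolP. Qed.

Lemma c0_bounded (x : c0) : bounded_norm_on [set: nat] x.
Proof.
have /cvgP/cvg_seq_bounded/pinfty_ex_gt0[M M0 xM] := @c0_cvg x.
exists (complex.Re M) => i _.
have -> : (complex.Re M)%:C = M by rewrite -[M]gtr0_norm// Re_norm.
exact: xM.
Qed.

Definition c0_norm (x : c0) : R[i] := (supnorm [set: nat] x)%:C.

Lemma ler_c0_normD (x y : c0) : c0_norm (x + y) <= c0_norm x + c0_norm y.
Proof.
rewrite -rmorphD lecR; apply: ler_supnormD; [by exists 0%N|..];
  exact: c0_bounded.
Qed.

Lemma c0_normZ (a : R[i]) (x : c0) : c0_norm (a *: x) = `|a| * c0_norm x.
Proof. by apply: supnormZ; [exists 0%N|exact: c0_bounded]. Qed.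

Lemma c0_norm_eq0 (x : c0) : c0_norm x = 0 -> x = 0.
Proof.
move=> x0; apply/val_inj/funext => i.
exact: (supnorm_eq0 (@c0_bounded x) x0).
Qed.

HB.instance Definition _ :=
  Lmodule_isNormed.Build R[i] c0 ler_c0_normD c0_normZ c0_norm_eq0.

End c0_space.

Section bilinear_forms.
Context (R : realType) (Z W : normedModType R[i]).

Definition unit_ball2 : set (Z * W) := [set p | `|p.1| <= 1 /\ `|p.2| <= 1].

(* [R[i]^o] is [R[i]] seen as a module over itself, normed by the modulus. *)
Definition bounded_bilinear : {pred Z -> W -> R[i]^o} :=
  fun T => `[< bilinear_for *:%R *:%R T /\
               bounded_norm_on unit_ball2 (fun p => T p.1 p.2) >].

Lemma bounded_bilinear_submod_closed : submod_closed bounded_bilinear.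
Proof.
split=> [|a S T /asboolP[Sb SM] /asboolP[Tb TM]]; apply/asboolP; split.
- by split=> u b x y /=; rewrite scaler0 addr0.
- by exists 0 => p _; rewrite normr0.
- split=> [w|z] b x y.
    change (a *: S (b *: x + y) w + T (b *: x + y) w =
            b *: (a *: S x w + T x w) + (a *: S y w + T y w)).
    rewrite (Sb.1 w b x y) (Tb.1 w b x y) /=.
    by rewrite !scalerDr !scalerA [a * b]mulrC addrACA.
  change (a *: S z (b *: x + y) + T z (b *: x + y) =
          b *: (a *: S z x + T z x) + (a *: S z y + T z y)).
  rewrite (Sb.2 z b x y) (Tb.2 z b x y) /=.
  by rewrite !scalerDr !scalerA [a * b]mulrC addrACA.
- exact: (bounded_norm_onD (bounded_norm_onZ a SM) TM).
Qed.

HB.instance Definition _ :=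
  GRing.isSubmodClosed.Build _ _ bounded_bilinear
    bounded_bilinear_submod_closed.

Record bilin_form := BilinForm {
  bilin_form_fun :> Z -> W -> R[i]^o ;
  _ : bilin_form_fun \in bounded_bilinear }.

HB.instance Definition _ := [isSub for bilin_form_fun].
HB.instance Definition _ := [Choice of bilin_form by <:].
HB.instance Definition _ := [SubChoice_isSubLmodule of bilin_form by <:].

Lemma bilin_form_bilinear (T : bilin_form) : bilinear_for *:%R *:%R T.
Proof. by case: T => T /= /asboolP[]. Qed.

Lemma bilin_form_bounded (T : bilin_form) :
  bounded_norm_on unit_ball2 (fun p => T p.1 p.2).
Proof. by case: T => T /= /asboolP[]. Qed.

HB.instance Definition _ (T : bilin_form) :=
  bilinear_isBilinear.Build R[i] Z W R[i]^o *:%R *:%R T (bilin_form_bilinear T).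

Definition bilin_form_norm (T : bilin_form) : R[i] :=
  (supnorm unit_ball2 (fun p => T p.1 p.2))%:C.

Lemma unit_ball2_neq0 : unit_ball2 !=set0.
Proof. by exists 0; split; rewrite /= normr0. Qed.

Lemma ler_bilin_form_normD (S T : bilin_form) :
  bilin_form_norm (S + T) <= bilin_form_norm S + bilin_form_norm T.
Proof.
rewrite -rmorphD lecR.
exact: (ler_supnormD unit_ball2_neq0
  (@bilin_form_bounded S) (@bilin_form_bounded T)).
Qed.

Lemma bilin_form_normZ (a : R[i]) (T : bilin_form) :
  bilin_form_norm (a *: T) = `|a| * bilin_form_norm T.
Proof. exact: (supnormZ a unit_ball2_neq0 (@bilin_form_bounded T)). Qed.

Lemma bilin_form_norm_eq0 (T : bilin_form) : bilin_form_norm T = 0 -> T = 0.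
Proof.
move=> T0; apply/val_inj/funext => z; apply/funext => w /=.
pose s : R[i] := `|z| + `|w| + 1.
have s_gt0 : 0 < s by rewrite ltr_wpDl// addr_ge0.
have s_neq0 : s != 0 by rewrite gt_eqF.
have in_ball : unit_ball2 (s^-1 *: z, s^-1 *: w).
  split; rewrite /= normrZ normfV (gtr0_norm s_gt0) ler_pdivrMl// mulr1.
    by rewrite /s -addrA lerDl addr_ge0.
  by rewrite /s [`|z| + _]addrC -addrA lerDl addr_ge0.
have := supnorm_eq0 (@bilin_form_bounded T) T0 in_ball.
rewrite /= linearZl_LR linearZr_LR /= => /eqP.
by rewrite !scaler_eq0 invr_eq0 (negPf s_neq0) /= => /eqP.
Qed.

HB.instance Definition _ :=
  Lmodule_isNormed.Build R[i] bilin_form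
    ler_bilin_form_normD bilin_form_normZ bilin_form_norm_eq0.

End bilinear_forms.

Section geometry.
Context (R : realType).

Definition unit_sphere (Z : normedModType R[i]) : set Z := [set z | `|z| = 1].

Definition uniformly_convex (X : normedModType R[i]) :=
  forall eps : R, 0 < eps <= 2 ->
    exists2 delta : R, 0 < delta &
      forall x y : X, unit_sphere x -> unit_sphere y ->
        eps%:C <= `|x - y| -> `|2^-1 *: (x + y)| <= (1 - delta)%:C.

(* Equivalently, the modulus of smoothness is [o(tau)] as [tau] tends to [0]. *)
Definition uniformly_smooth (X : normedModType R[i]) :=
  forall eps : R, 0 < eps ->
    exists2 delta : R, 0 < delta &
      forall x y : X, unit_sphere x -> `|y| <= delta%:C ->
        `|x + y| + `|x - y| <= 2 + eps%:C * `|y|.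

(* Bishop-Phelps-Bollobas property for bilinear forms of the pair [(Z, W)];
   [eta] depends on [eps] only. *)
Definition BPBp_bilinear (Z W : normedModType R[i]) :=
  forall eps : R, 0 < eps ->
    exists2 eta : R, 0 < eta &
      forall (T : bilin_form Z W) (x0 : Z) (y0 : W),
        unit_sphere T -> unit_sphere x0 -> unit_sphere y0 ->
        (1 - eta)%:C < `|T x0 y0| ->
        exists (S : bilin_form Z W) (u0 : Z) (v0 : W),
          [/\ unit_sphere S, unit_sphere u0 & unit_sphere v0] /\
          [/\ `|S u0 v0| = 1, `|u0 - x0| < eps%:C,
              `|v0 - y0| < eps%:C & `|S - T| < eps%:C].

End geometry.

(* Main.v *)
(** Write [A] for the coordinates where [x0] has norm close to [1], and [B] for
    those of [y0]; both are finite. If [T(x0, y0)] is close to [1] and [z] lives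
    where [|x0(i)| <= 1 - d], then [x0 + c d z] stays in the ball for every
    unimodular [c], and smoothness of [X] forces [T(z, .)] to be small (the dual
    of [c0(X)] is complex uniformly convex). Hence [T] is close to its
    restriction [S] to [A x B]. On finitely many coordinates, uniform convexity
    makes the points with unit coordinates uniformly strongly exposed, so by
    Lindenstrauss' iteration a small perturbation [G] of
    [S + t c S(., y) S(x, .)] attains its norm, at some [(x1, y1)]. The added
    product forces [S(x1, y)] and [S(x, y1)] to be almost maximal, hence, after
    a rotation, [x1] is close to [x] except on a set [D] of coordinates that
    carries little mass of [S]; similarly for [y1]. Composing [G] on [D] with
    the rank-one contractions sending [x(i)] to [x1(i)] moves the maximiser next
    to [(x0, y0)] and changes [G] only slightly. *)
Require Import Defs.
From mathcomp Require Import all_boot all_order all_algebra.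
From mathcomp Require Import complex.
From mathcomp Require Import all_classical all_reals all_analysis.
From mathcomp Require Import ring lra.

Set Implicit Arguments.
Unset Strict Implicit.
Unset Printing Implicit Defensive.

Import Order.TTheory GRing.Theory Num.Theory.
Import numFieldNormedType.Exports.

Local Open Scope classical_set_scope.
Local Open Scope ring_scope.
Local Open Scope complex_scope.

(** * The real-valued norm *)

Section real_norm.
Context (R : realType).

(** With values in [R], norm estimates come within reach of [lra] and [nra]. *)
Definition nrm (V : normedZmodType R[i]) (v : V) : R := complex.Re `|v|.

Lemma nrmE (V : normedZmodType R[i]) (v : V) : `|v| = (nrm v)%:C.
Proof. by rewrite /nrm Re_norm. Qed.

Section zmod.
Context (V : normedZmodType R[i]).
Implicit Types v w : V.

Lemma nrm_ge0 v : 0 <= nrm v.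
Proof. by rewrite -lecR -nrmE normr_ge0. Qed.

Lemma nrm0 : nrm (0 : V) = 0.
Proof. by rewrite /nrm normr0. Qed.

Lemma nrm_eq0 v : nrm v = 0 -> v = 0.
Proof. by move=> v0; apply/normr0_eq0; rewrite nrmE v0. Qed.

Lemma nrmN v : nrm (- v) = nrm v.
Proof. by rewrite /nrm normrN. Qed.

Lemma nrmB v w : nrm (v - w) = nrm (w - v).
Proof. by rewrite /nrm distrC. Qed.

Lemma nrmD v w : nrm (v + w) <= nrm v + nrm w.
Proof. by rewrite -lecR rmorphD /= -!nrmE ler_normD. Qed.

Lemma nrmBD v w : nrm (v - w) <= nrm v + nrm w.
Proof. by rewrite -[nrm w]nrmN nrmD. Qed.

Lemma nrm_sub v w : nrm v - nrm w <= nrm (v - w).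
Proof. by rewrite lerBlDr -{1}[v](subrK w) nrmD. Qed.

Lemma nrm_tri u v w : nrm (u - w) <= nrm (u - v) + nrm (v - w).
Proof. by rewrite -{1}[u](subrK v) -addrA nrmD. Qed.

Lemma nrm_sum (I : Type) (s : seq I) (P : pred I) (F : I -> V) :
  nrm (\sum_(i <- s | P i) F i) <= \sum_(i <- s | P i) nrm (F i).
Proof.
elim/big_rec2 : _ => [|i y1 y2 _ h]; first by rewrite nrm0.
by apply: (le_trans (nrmD _ _)); rewrite lerD2l.
Qed.

End zmod.

Lemma nrmM (a b : R[i]) : nrm (a * b) = nrm a * nrm b.
Proof. by apply: complexI; rewrite -nrmE normrM !nrmE rmorphM. Qed.

Lemma nrmZ (V : normedModType R[i]) (a : R[i]) (v : V) :
  nrm (a *: v) = nrm a * nrm v.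
Proof. by apply: complexI; rewrite -nrmE normrZ !nrmE rmorphM. Qed.

Lemma nrmc (a : R[i]) :
  nrm a = Num.sqrt (complex.Re a ^+ 2 + complex.Im a ^+ 2).
Proof. by rewrite /nrm normc_def. Qed.

Lemma nrmR (a : R) : nrm a%:C = `|a|.
Proof. by rewrite nrmc /= expr0n /= addr0 sqrtr_sqr. Qed.

Lemma nrm1 : nrm (1 : R[i]) = 1.
Proof. by rewrite -[1]/(1%:C) nrmR normr1. Qed.

Lemma nrm_nat (n : nat) : nrm (n%:R : R[i]) = n%:R.
Proof. by rewrite -(rmorph_nat (real_complex R)) nrmR ger0_norm. Qed.

Lemma nrmi : nrm ('i : R[i]) = 1.
Proof. by rewrite nrmc /= expr0n /= expr1n add0r sqrtr1. Qed.

Lemma nrmV (a : R[i]) : nrm a^-1 = (nrm a)^-1.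
Proof. by apply: complexI; rewrite -nrmE normfV nrmE fmorphV. Qed.

Lemma nrmZr (V : normedModType R[i]) (a : R) (v : V) :
  nrm (a%:C *: v) = `|a| * nrm v.
Proof. by rewrite nrmZ nrmR. Qed.

Lemma Re_le_nrm (a : R[i]) : complex.Re a <= nrm a.
Proof.
rewrite nrmc; apply: (le_trans (ler_norm _)).
by rewrite -sqrtr_sqr; apply: ler_wsqrtr; rewrite lerDl sqr_ge0.
Qed.

Lemma Im_le_nrm (a : R[i]) : `|complex.Im a| <= nrm a.
Proof. by rewrite nrmc -sqrtr_sqr ler_wsqrtr// lerDr sqr_ge0. Qed.

Lemma normRe_le_nrm (a : R[i]) : `|complex.Re a| <= nrm a.
Proof. by rewrite nrmc -sqrtr_sqr ler_wsqrtr// lerDl sqr_ge0. Qed.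

Lemma phase (a : R[i]) : exists2 c : R[i], nrm c = 1 & c * a = (nrm a)%:C.
Proof.
have [->|a0] := eqVneq a 0.
  by exists 1; rewrite ?nrm1// mulr0 nrm0.
have na0 : nrm a != 0 by apply: contra_neq a0 => /nrm_eq0.
exists ((nrm a)%:C / a); first by rewrite nrmM nrmV nrmR ger0_norm ?nrm_ge0// divff.
by rewrite divfK.
Qed.

Lemma nrm_unit (V : normedModType R[i]) (v : V) : v != 0 ->
  nrm ((nrm v)^-1%:C *: v) = 1.
Proof.
move=> v0; have na0 : nrm v != 0 by apply: contra_neq v0 => /nrm_eq0.
by rewrite nrmZr ger0_norm ?invr_ge0 ?nrm_ge0// mulVf.
Qed.

(** At [v = 0] both sides vanish, so vectors can be normalised without a case distinction. *)
Lemma nrm_unitK (V : normedModType R[i]) (v : V) :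
  (nrm v)%:C *: ((nrm v)^-1%:C *: v) = v.
Proof.
have [->|v0] := eqVneq v 0; first by rewrite !scaler0.
have na0 : nrm v != 0 by apply: contra_neq v0 => /nrm_eq0.
by rewrite scalerA -rmorphM /= divff// scale1r.
Qed.

Lemma nrm_unit_le (V : normedModType R[i]) (v : V) :
  nrm ((nrm v)^-1%:C *: v) <= 1.
Proof.
have [->|v0] := eqVneq v 0; first by rewrite scaler0 nrm0.
by rewrite nrm_unit.
Qed.

Lemma unit_sphereE (V : normedModType R[i]) (v : V) :
  unit_sphere v <-> nrm v = 1.
Proof.
rewrite /unit_sphere /= nrmE; split=> [|->//].
by move/complexI.
Qed.

Lemma bound_cvg0 (C : R) (e : R) : 0 < e -> exists k : nat, C * 2^-1 ^+ k < e.
Proof.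
move=> e0; have [C0|C0] := leP C 0.
  by exists 0%N; rewrite expr0 mulr1; lra.
have : (C * (2^-1 : R) ^+ k) @[k --> \oo] --> C * 0.
  by apply: cvgMr; apply: cvg_expr; rewrite ger0_norm; lra.
rewrite mulr0 => /cvgrPdist_lt /(_ e e0) [k _ /(_ k (leqnn k))] /=.
by rewrite sub0r normrN => h; exists k; apply: le_lt_trans h; exact: ler_norm.
Qed.

(** The right-hand side is the exact geometric sum over [k, ..., l - 1], the form that an induction
    on [l - k] preserves. *)
Lemma geometric_tail (V : normedZmodType R[i]) (u : nat -> V) (C : R) :
  (forall k, nrm (u k.+1 - u k) <= C * 2^-1 ^+ k) ->
  forall k l, (k <= l)%N -> nrm (u l - u k) <= C * (2 * (2^-1 ^+ k - 2^-1 ^+ l)).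
Proof.
move=> h k l /subnK <-; elim: (l - k)%N => [|n IH].
  by rewrite subrr nrm0 subrr !mulr0.
rewrite addSn; apply: (le_trans (nrm_tri _ (u (n + k)%N) _)).
have := h (n + k)%N; rewrite exprS; nra.
Qed.

End real_norm.

(** * Limits of geometrically Cauchy sequences *)

Section completeness.
Context (R : realType) (X : completeNormedModType R[i]).

Lemma geometric_cvg (u : nat -> X) (C : R) :
  (forall k, nrm (u k.+1 - u k) <= C * 2^-1 ^+ k) ->
  exists l, forall k, nrm (u k - l) <= 2 * C * 2^-1 ^+ k.
Proof.
move=> h; have tail := geometric_tail h.
have C0 : 0 <= C.
  by have := h 0%N; rewrite expr0 mulr1; apply: le_trans; exact: nrm_ge0.
have p0 k : (0 : R) <= 2^-1 ^+ k by rewrite exprn_ge0.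
have tail' k l : (k <= l)%N -> nrm (u l - u k) <= 2 * C * 2^-1 ^+ k.
  move=> /tail/le_trans; apply; have := p0 l; have := p0 k; nra.
have : cauchy (u @ \oo).
  apply: cauchy_exP => e e0.
  have eE : e = (complex.Re e)%:C by rewrite -[e]gtr0_norm// Re_norm.
  have e0' : 0 < complex.Re e by rewrite -ltcR -eE.
  have [k hk] := bound_cvg0 (2 * C) e0'.
  exists (u k), k => // l /= kl.
  rewrite -ball_normE /ball_/= nrmE eE ltcR nrmB.
  exact: le_lt_trans (tail' _ _ kl) hk.
move=> /cauchy_cvg uc; exists (lim (u @ \oo)) => k.
rewrite leNgt; apply/negP => hk.
(* The amount by which the limit would violate the bound serves as tolerance: some later term is
   closer to the limit than [e], against the tail estimate. *)
set e := nrm (u k - lim (u @ \oo)) - 2 * C * 2^-1 ^+ k in hk *.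
have e0 : 0 < e by rewrite subr_gt0.
have /cvgrPdist_lt /(_ e%:C) : u l @[l --> \oo] --> lim (u @ \oo) by [].
rewrite ltcR => /(_ e0) [N _ hN].
have := hN (maxn k N) (leq_maxr _ _); rewrite /= nrmE ltcR => h1.
have h2 := tail' _ _ (leq_maxl k N).
have := nrm_tri (u k) (u (maxn k N)) (lim (u @ \oo)).
rewrite (nrmB (u k) (u _)) (nrmB (u (maxn k N)) (lim _)).
by move: h1 h2; rewrite /e; lra.
Qed.

End completeness.

(** * Support functionals *)

Section functionals.
Context (R : realType) (V : normedModType R[i]).

(** Members of the closed unit ball of the dual, kept as plain functions so that no normed dual
    space has to be built. *)
Definition contractive_functional (f : V -> R[i]) :=
  (forall a u v, f (a *: u + v) = a * f u + f v) /\
  (forall u, nrm (f u) <= nrm u).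

Lemma contractive_functional0 f : contractive_functional f -> f 0 = 0.
Proof.
move=> [_ fc]; apply/nrm_eq0/le_anti; rewrite nrm_ge0 andbT.
by apply: le_trans (fc _) _; rewrite nrm0.
Qed.

Lemma uniformly_smooth_real (e : R) : uniformly_smooth V -> 0 < e ->
  exists2 d : R, 0 < d & forall x y : V, nrm x = 1 -> nrm y <= d ->
    nrm (x + y) + nrm (x - y) <= 2 + e * nrm y.
Proof.
move=> sm /sm[d d0 h]; exists d => // x y x1 yd.
rewrite -lecR !rmorphD rmorphM /= -!nrmE; apply: h.
  exact/unit_sphereE.
by rewrite nrmE lecR.
Qed.

(* The one-sided directional derivative of the norm at a unit vector; smoothness
   makes it odd, hence real-linear. *)
Section norm_derivative.
Context (sm : uniformly_smooth V) (v : V) (v1 : nrm v = 1).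

Let q (t : R) (y : V) : R := (nrm (v + t%:C *: y) - 1) / t.
(** The quotient is nondecreasing in [t] and bounded below, so this infimum is its limit as [t]
    decreases to 0. *)
Let p (y : V) : R := inf [set q t y | t in [set t | 0 < t]].

Let q_ge (t : R) y : 0 < t -> - nrm y <= q t y.
Proof.
move=> t0; rewrite /q ler_pdivlMr// lerBrDr.
have := nrm_sub v (- (t%:C *: y)).
by rewrite opprK nrmN nrmZr gtr0_norm// v1; lra.
Qed.

Let p_le (t : R) y : 0 < t -> p y <= q t y.
Proof.
move=> t0; apply: ge_inf; last by exists t.
by exists (- nrm y) => _ [s s0 <-]; exact: q_ge.
Qed.

Let le_p (M : R) y : (forall t : R, 0 < t -> M <= q t y) -> M <= p y.
Proof.
move=> h; apply: lb_le_inf; first by exists (q 1 y), 1 => //=.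
by move=> _ [s s0 <-]; exact: h.
Qed.

(** Convexity of the norm: [v + s y] is the convex combination of [v] and [v + t y] with weight
    [s / t] on the latter. *)
Let q_mono (s t : R) y : 0 < s -> s <= t -> q s y <= q t y.
Proof.
move=> s0 st; have t0 : 0 < t by lra.
have h : nrm (v + s%:C *: y) <= (1 - s / t) + s / t * nrm (v + t%:C *: y).
  have -> : v + s%:C *: y =
      (1 - s / t)%:C *: v + (s / t)%:C *: (v + t%:C *: y).
    rewrite scalerDr scalerA -rmorphM /= divfK ?gt_eqF// addrA -scalerDl.
    by rewrite -rmorphD /= subrK scale1r.
  apply: (le_trans (nrmD _ _)); rewrite !nrmZr v1 mulr1.
  have st0 : 0 <= s / t by rewrite divr_ge0// ltW.
  have st1 : s / t <= 1 by rewrite ler_pdivrMr// mul1r.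
  by rewrite !ger0_norm//; lra.
rewrite /q ler_pdivrMr//.
have -> : (nrm (v + t%:C *: y) - 1) / t * s =
          s / t * (nrm (v + t%:C *: y) - 1) by ring.
lra.
Qed.

Let pD_le x y : p (x + y) <= p x + p y.
Proof.
rewrite -lerBlDr; apply: le_p => s s0.
rewrite lerBlDr [leRHS]addrC -lerBlDr; apply: le_p => t t0.
rewrite lerBlDr [leRHS]addrC.
set m := Num.min s t; have m0 : 0 < m by rewrite lt_min s0 t0.
have h1 : q m x <= q s x by apply: q_mono; rewrite // ge_min lexx.
have h2 : q m y <= q t y by apply: q_mono; rewrite // ge_min lexx orbT.
(* The step is halved because [v + (m / 2) (x + y)] is the midpoint of [v + m x] and [v + m y]. *)
have m2 : 0 < m / 2 by lra.
apply: (le_trans (p_le (x + y) m2)).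
suff : q (m / 2) (x + y) <= q m x + q m y by lra.
have : nrm (v + (m / 2)%:C *: (x + y)) <=
    2^-1 * (nrm (v + m%:C *: x) + nrm (v + m%:C *: y)).
  have -> : v + (m / 2)%:C *: (x + y) =
      (2^-1)%:C *: ((v + m%:C *: x) + (v + m%:C *: y)).
    have half : (2^-1)%:C *: (v + v) = v.
      rewrite -mulr2n -(scaler_nat 2 v) scalerA -(rmorph_nat (real_complex R)).
      by rewrite -rmorphM /= mulVf ?pnatr_eq0// scale1r.
    rewrite addrACA -scalerDr [RHS]scalerDr half scalerA -rmorphM /=.
    by rewrite [m / 2]mulrC.
  by rewrite nrmZr gtr0_norm// ler_pM2l// nrmD.
rewrite /q -mulrDl => h.
rewrite ler_pdivrMr// mulrA divfK ?gt_eqF//; lra.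
Qed.

Let p0 : p 0 = 0.
Proof.
apply/le_anti/andP; split.
  have := p_le 0 ltr01; rewrite /q scaler0 addr0 v1 subrr mul0r//.
by apply: le_p => t _; rewrite /q scaler0 addr0 v1 subrr mul0r.
Qed.

(** Smoothness enters here: [q t y + q t (- y)] is at most a small multiple of [nrm y] when [t] is
    small. The opposite inequality is subadditivity. *)
Let pN y : p (- y) = - p y.
Proof.
have h1 : 0 <= p y + p (- y) by rewrite -p0 -(subrr y) pD_le.
suff : p y + p (- y) <= 0 by lra.
apply/ler_addgt0Pr => e e0; rewrite add0r.
have n1 : 0 < nrm y + 1 by have := nrm_ge0 y; lra.
have e1 : 0 < e / (nrm y + 1) by rewrite divr_gt0.
have [d d0 h] := uniformly_smooth_real sm e1.
have t0 : 0 < d / (nrm y + 1) by rewrite divr_gt0.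
move: t0 (h v ((d / (nrm y + 1))%:C *: y) v1); set t := d / _ => t0.
rewrite nrmZr gtr0_norm// => ht.
have tyd : t * nrm y <= d.
  by rewrite /t mulrAC ler_pdivrMr// ler_pM2l//; lra.
have := p_le y t0; have := p_le (- y) t0.
rewrite /q scalerN => h2 h3.
have h4 : q t y + q t (- y) <= e / (nrm y + 1) * nrm y.
  rewrite /q -mulrDl scalerN ler_pdivrMr//.
  by have := ht tyd; rewrite mulrA mulrAC -mulrA [_ * t]mulrC; lra.
have h5 : e / (nrm y + 1) * nrm y <= e.
  by rewrite mulrAC ler_pdivrMr// ler_pM2l//; lra.
by move: h4; rewrite /q scalerN; lra.
Qed.

Let pD x y : p (x + y) = p x + p y.
Proof.
apply/le_anti; rewrite pD_le /=.
by have := pD_le (x + y) (- y); rewrite addrK pN; lra.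
Qed.

(** Rescaling [t] gives one inequality for every positive factor; the same inequality for [a^-1]
    gives the other. *)
Let pZ_gt0 (a : R) y : 0 < a -> p (a%:C *: y) = a * p y.
Proof.
have ge b z : 0 < b -> b * p z <= p (b%:C *: z).
  move=> b0; apply: le_p => t t0; rewrite mulrC -ler_pdivlMr//.
  have -> : q t (b%:C *: z) / b = q (t * b) z.
    by rewrite /q scalerA -rmorphM /= invfM; ring.
  by apply: p_le; rewrite mulr_gt0.
move=> a0; apply/le_anti; rewrite ge// andbT.
have ai0 : 0 < a^-1 by rewrite invr_gt0.
have := ge _ (a%:C *: y) ai0; rewrite scalerA -rmorphM /= mulVf ?gt_eqF//.
by rewrite scale1r mulrC ler_pdivrMr// mulrC.
Qed.

Let pZ (a : R) y : p (a%:C *: y) = a * p y.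
Proof.
have [a0|a0|<-] := ltgtP 0 a; first exact: pZ_gt0; last first.
  by rewrite scale0r p0 mul0r.
rewrite -[a%:C]opprK -rmorphN scaleNr pN pZ_gt0 ?oppr_gt0//; ring.
Qed.

Let p_nrm y : p y <= nrm y.
Proof.
have := p_le y ltr01; rewrite /q scale1r divr1.
by have := nrmD v y; rewrite v1; lra.
Qed.

Let pv : p v = 1.
Proof.
have qv t : 0 < t -> q t v = 1.
  move=> t0; have -> : q t v = (nrm ((1 + t)%:C *: v) - 1) / t.
    by rewrite /q rmorphD rmorph1 scalerDl scale1r.
  rewrite nrmZr gtr0_norm ?addr_gt0// v1 mulr1 addrC addKr.
  by rewrite divff ?gt_eqF.
apply/le_anti/andP; split; first by rewrite -(qv 1 ltr01) p_le.
by apply: le_p => t t0; rewrite qv.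
Qed.

(** The norm grows only to second order in the direction ['i v], as
    [|1 + i e| = sqrt (1 + e^2) <= 1 + e^2]. This makes the value of the complex functional at [v]
    real. *)
Let piv : p ('i *: v) = 0.
Proof.
have h s : s ^+ 2 = 1 -> p (s%:C *: ('i *: v)) <= 0.
  move=> s1; apply/ler_addgt0Pr => e e0; rewrite add0r.
  apply: (le_trans (p_le _ e0)); rewrite /q ler_pdivrMr// lerBlDr.
  have -> : v + e%:C *: (s%:C *: ('i *: v)) = (1 + e%:C * (s%:C * 'i)) *: v.
    by rewrite scalerDl scale1r !scalerA mulrA.
  rewrite nrmZ v1 mulr1 nrmc /= !(mul0r, mulr0, mulr1, oppr0, addr0, add0r).
  have -> : (1 : R) ^+ 2 + (e * s) ^+ 2 = 1 + e ^+ 2 by rewrite exprMn s1; ring.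
  have e20 : 0 <= e * e + 1 by nra.
  by rewrite -(ger0_norm e20) -sqrtr_sqr ler_wsqrtr//; nra.
have := h 1 (expr1n _ _); have := h (-1) (etrans (sqrrN 1) (expr1n _ _)).
by rewrite !pZ; lra.
Qed.

(** The functional is the complexification [p y - i p (i y)] of the real-linear derivative [p]; it
    is explicit and takes the place of a Hahn-Banach extension. *)
Lemma unit_support_functional :
  exists2 f : V -> R[i], contractive_functional f & f v = 1.
Proof.
pose f y : R[i] := p y +i* (- p ('i *: y)).
have fD x y : f (x + y) = f x + f y.
  by rewrite /f scalerDr !pD opprD.
have fi y : f ('i *: y) = 'i * f y.
  apply/eqP; rewrite eq_complex /f /= scalerA -expr2 sqr_i scaleN1r pN.
  by rewrite !(mul0r, mul1r, opprK, sub0r, add0r, addr0) !eqxx.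
have fr (a : R) y : f (a%:C *: y) = a%:C * f y.
  have ia : 'i *: (a%:C *: y) = a%:C *: ('i *: y) by rewrite !scalerA mulrC.
  apply/eqP; rewrite eq_complex /f ia !pZ /=.
  by rewrite !(mul0r, subr0, addr0) eqxx -(mulrN a (p _)) eqxx.
have fZ a y : f (a *: y) = a * f y.
  rewrite [in LHS](complexE a) scalerDl -scalerA fD fr fi fr mulrA -mulrDl.
  by rewrite -complexE.
exists f; last first.
  by apply/eqP; rewrite eq_complex /f /= pv piv oppr0 !eqxx.
split=> [a x y|y]; first by rewrite fD fZ.
(* After rotating [y], the value of [f] is real and nonnegative, hence equal to its real part [p],
   which the norm dominates. *)
have [c c1 cf] := phase (f y).
have : p (c *: y) <= nrm (c *: y) by exact: p_nrm.
have -> : p (c *: y) = complex.Re (f (c *: y)) by [].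
by rewrite fZ cf /= nrmZ c1 mul1r.
Qed.

End norm_derivative.

Lemma support_functional (v : V) : uniformly_smooth V ->
  exists2 f : V -> R[i], contractive_functional f & f v = (nrm v)%:C.
Proof.
move=> sm; have [->|v0] := eqVneq v 0.
  exists (fun=> 0); last by rewrite nrm0.
  by split=> *; rewrite ?nrm0 ?nrm_ge0// mulr0 addr0.
have [f fP f1] := unit_support_functional sm (nrm_unit v0).
exists f => //; have f0 := contractive_functional0 fP; have [fl _] := fP.
have := fl (nrm v)%:C ((nrm v)^-1%:C *: v) 0.
by rewrite nrm_unitK addr0 f0 addr0 f1 mulr1.
Qed.

End functionals.

(** * Coordinates and bilinear forms *)

Section sequences.
Context (R : realType) (X : normedModType R[i]).
Implicit Types (x y : c0 X) (s : seq nat).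

Lemma c0_ext x y : (forall i, x i = y i) -> x = y.
Proof. by move=> h; apply/val_inj/funext. Qed.

Lemma nrm_c0_coord x i : nrm (x i) <= nrm x.
Proof.
rewrite -lecR -!nrmE.
exact: (le_supnorm (@c0_bounded _ _ x)).
Qed.

Lemma nrm_c0_le x (M : R) : (forall i, nrm (x i) <= M) -> nrm x <= M.
Proof.
move=> h; rewrite /nrm [`|x|]/(c0_norm x) /=.
by apply: supnorm_le; [exists 0%N|move=> i _; rewrite nrmE lecR].
Qed.

Lemma c0_eventually x (e : R) : 0 < e ->
  exists N, forall i, (N <= i)%N -> nrm (x i) < e.
Proof.
move=> e0; have /cvgrPdist_lt /(_ e%:C) := @c0_cvg _ _ x.
rewrite ltcR => /(_ e0) [N _ h]; exists N => i /h /=.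
by rewrite sub0r normrN nrmE ltcR.
Qed.

Lemma null_seq_small (f : nat -> X) :
  (forall e : R, 0 < e -> exists N, forall i, (N <= i)%N -> nrm (f i) < e) ->
  f \in @null_seq _ X.
Proof.
move=> h; apply/asboolP/cvgrPdist_lt => e e0.
have eE : e = (complex.Re e)%:C by rewrite -[e]gtr0_norm// Re_norm.
have [|N hN] := h (complex.Re e); first by rewrite -ltcR -eE.
by exists N => // i /= /hN; rewrite sub0r normrN nrmE eE ltcR.
Qed.

(* Junk value [0] unless the maps [F i] are uniformly Lipschitz at [0]. *)
Definition coordmap (F : nat -> X -> X) (x : c0 X) : c0 X :=
  insubd (0 : c0 X) (fun i => F i (x i)).

Lemma coordmapE F C x i : (forall i v, nrm (F i v) <= C * nrm v) ->
  coordmap F x i = F i (x i).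
Proof.
move=> h; rewrite /coordmap.
suff /(insubdK (0 : c0 X)) : (fun i => F i (x i)) \in @null_seq _ X.
  by move=> /= ->.
apply: null_seq_small => e e0.
have C0 : 0 < `|C| + 1 by rewrite ltr_wpDl.
have e1 : 0 < e / (`|C| + 1) by rewrite divr_gt0.
have [N hN] := c0_eventually x e1; exists N => j /hN.
rewrite ltr_pdivlMr// => hj; apply: le_lt_trans hj.
apply: (le_trans (h _ _)); rewrite mulrC ler_wpM2l ?nrm_ge0//.
by apply: (le_trans (ler_norm _)); rewrite lerDl.
Qed.

Lemma coordmap_linear F C : (forall i v, nrm (F i v) <= C * nrm v) ->
  (forall i (a : R[i]) v w, F i (a *: v + w) = a *: F i v + F i w) ->
  forall (a : R[i]) x y,
    coordmap F (a *: x + y) = a *: coordmap F x + coordmap F y.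
Proof.
move=> h l a x y; apply: c0_ext => i.
rewrite (coordmapE _ _ h).
have -> : (a *: x + y) i = a *: x i + y i by [].
by rewrite l -!(coordmapE _ _ h).
Qed.

Lemma coordmap_le F C x : 0 <= C -> (forall i v, nrm (F i v) <= C * nrm v) ->
  nrm (coordmap F x) <= C * nrm x.
Proof.
move=> C0 h; apply: nrm_c0_le => i; rewrite (coordmapE _ _ h).
by apply: (le_trans (h _ _)); rewrite ler_wpM2l// nrm_c0_coord.
Qed.

Definition restrict (D : pred nat) : c0 X -> c0 X :=
  coordmap (fun i v => if D i then v else 0).

Let restrict_le1 (D : pred nat) i v :
  nrm (if D i then v else 0 : X) <= 1 * nrm v.
Proof. by rewrite mul1r; case: ifP; rewrite ?nrm0 ?nrm_ge0. Qed.

Lemma restrictE D x i : restrict D x i = if D i then x i else 0.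
Proof. exact: (coordmapE _ _ (restrict_le1 D)). Qed.

Lemma restrict_le D x : nrm (restrict D x) <= nrm x.
Proof.
by rewrite -[leRHS]mul1r; apply: coordmap_le => //; exact: restrict_le1.
Qed.

Lemma restrictC D x : x = restrict D x + restrict (predC D) x.
Proof.
apply: c0_ext => i.
have -> : (restrict D x + restrict (predC D) x) i =
  restrict D x i + restrict (predC D) x i by [].
by rewrite !restrictE /=; case: (D i); rewrite ?addr0 ?add0r.
Qed.

End sequences.

(** * Bounded bilinear forms: evaluation, norm bounds and construction *)

Section bilinear.
Context (R : realType) (Z W : normedModType R[i]).
Implicit Types (T : bilin_form Z W).

Lemma bf_linl T (a : R[i]) x x' y : T (a *: x + x') y = a * T x y + T x' y.
Proof. exact: (@bilin_form_bilinear _ _ _ T).1. Qed.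

Lemma bf_linr T (a : R[i]) x y y' : T x (a *: y + y') = a * T x y + T x y'.
Proof. exact: (@bilin_form_bilinear _ _ _ T).2. Qed.

Lemma bf_Dl T x x' y : T (x + x') y = T x y + T x' y.
Proof. by rewrite -{1}[x]scale1r bf_linl mul1r. Qed.

Lemma bf_Dr T x y y' : T x (y + y') = T x y + T x y'.
Proof. by rewrite -{1}[y]scale1r bf_linr mul1r. Qed.

Lemma bf_0l T y : T 0 y = 0.
Proof. exact: linear0l. Qed.

Lemma bf_0r T x : T x 0 = 0.
Proof. exact: linear0r. Qed.

Lemma bf_Zl T (a : R[i]) x y : T (a *: x) y = a * T x y.
Proof. by rewrite -[a *: x]addr0 bf_linl bf_0l addr0. Qed.

Lemma bf_Zr T (a : R[i]) x y : T x (a *: y) = a * T x y.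
Proof. by rewrite -[a *: y]addr0 bf_linr bf_0r addr0. Qed.

Lemma bf_Nl T x y : T (- x) y = - T x y.
Proof. by rewrite -scaleN1r bf_Zl mulN1r. Qed.

Lemma bf_Nr T x y : T x (- y) = - T x y.
Proof. by rewrite -scaleN1r bf_Zr mulN1r. Qed.

Lemma bf_ball T x y : nrm x <= 1 -> nrm y <= 1 -> nrm (T x y) <= nrm T.
Proof.
move=> x1 y1; rewrite -lecR -!nrmE.
apply: (@le_supnorm _ _ _ _ (fun p => T p.1 p.2) (x, y)).
  exact: bilin_form_bounded.
by split; rewrite /= nrmE lecR.
Qed.

Lemma bf_le T x y : nrm (T x y) <= nrm T * nrm x * nrm y.
Proof.
rewrite -{1}[x]nrm_unitK -{1}[y]nrm_unitK bf_Zl bf_Zr !nrmM !nrmR.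
rewrite !ger0_norm ?nrm_ge0//.
have h := bf_ball T (nrm_unit_le x) (nrm_unit_le y).
have ab : 0 <= nrm x * nrm y by rewrite mulr_ge0 ?nrm_ge0.
by rewrite [leLHS]mulrA -[leRHS]mulrA [leRHS]mulrC; exact: ler_wpM2l.
Qed.

Lemma bf_norm_le T (M : R) :
  (forall x y, nrm x <= 1 -> nrm y <= 1 -> nrm (T x y) <= M) -> nrm T <= M.
Proof.
move=> h; rewrite /nrm [`|T|]/(bilin_form_norm T) /=.
apply: supnorm_le; first exact: unit_ball2_neq0.
by move=> [x y] [/= x1 y1]; rewrite nrmE lecR h// -lecR -nrmE.
Qed.

Lemma bf_near_norm T (e : R) : 0 < e ->
  exists x y, [/\ nrm x <= 1, nrm y <= 1 & nrm T - e < nrm (T x y)].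
Proof.
move=> e0; apply: contrapT => h.
suff : nrm T <= nrm T - e by lra.
apply: bf_norm_le => x y x1 y1; rewrite leNgt; apply/negP => h'.
by apply: h; exists x, y.
Qed.

Lemma bf_mk (f : Z -> W -> R[i]) (M : R) :
  (forall (a : R[i]) x x' y, f (a *: x + x') y = a * f x y + f x' y) ->
  (forall (a : R[i]) x y y', f x (a *: y + y') = a * f x y + f x y') ->
  (forall x y, nrm x <= 1 -> nrm y <= 1 -> nrm (f x y) <= M) ->
  exists T : bilin_form Z W, forall x y, T x y = f x y.
Proof.
move=> fl fr fM.
suff fb : f \in @bounded_bilinear _ Z W by exists (BilinForm fb).
apply/asboolP; split; first by split=> u a x y /=; [exact: fl|exact: fr].
exists M => -[x y] [/= x1 y1].
by rewrite nrmE lecR fM// -lecR -nrmE.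
Qed.

Lemma bf_addE T T' x y : (T + T') x y = T x y + T' x y.
Proof. by []. Qed.

Lemma bf_subE T T' x y : (T - T') x y = T x y - T' x y.
Proof. by []. Qed.

Lemma bf_scaleE (a : R[i]) T x y : (a *: T) x y = a * T x y.
Proof. by []. Qed.

End bilinear.

(** * Complex convexity of the dual *)

Section complex_convexity.
Context (R : realType) (X : normedModType R[i]).

(** Adding [T (x + c z) (y + t w)] and [T (x - c z) (y - t w)] cancels the mixed terms. With [c]
    aligning the phases of [T x y] and [T z w], the sum has modulus [2 (|T x y| + t |T z w|)], and
    it is at most [2 (1 + e t)]. *)
Lemma tangent_bound (Z W : normedModType R[i]) (T : bilin_form Z W)
    x y z w (eta t e : R) : 0 < t -> nrm T <= 1 ->
  1 - eta < nrm (T x y) ->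
  (forall c, nrm c = 1 -> nrm (x + c *: z) <= 1) ->
  nrm (y + t%:C *: w) <= 1 + e * t -> nrm (y - t%:C *: w) <= 1 + e * t ->
  nrm (T z w) <= eta / t + e.
Proof.
move=> t0 T1 hT hz h1 h2.
have [c1 c11 c1a] := phase (T x y).
have [c2 c21 c2b] := phase (T z w).
have c10 : c1 != 0 by apply/eqP => c10; move: c11; rewrite c10 nrm0; lra.
pose c := c2 / c1.
have nc : nrm c = 1 by rewrite nrmM nrmV c11 c21 invr1 mulr1.
have E : T (x + c *: z) (y + t%:C *: w) + T (x - c *: z) (y - t%:C *: w) =
    2 * (T x y + c * t%:C * T z w).
  rewrite !(bf_Dl, bf_Dr, bf_Nl, bf_Nr, bf_Zl, bf_Zr); ring.
have E2 : c1 * (T x y + c * t%:C * T z w) =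
    (nrm (T x y) + t * nrm (T z w))%:C.
  rewrite mulrDr c1a rmorphD rmorphM /= -c2b /c; congr (_ + _).
  by field.
have E3 : nrm (T x y + c * t%:C * T z w) = nrm (T x y) + t * nrm (T z w).
  rewrite -[LHS]mul1r -c11 -nrmM E2 nrmR ger0_norm//.
  by rewrite addr_ge0 ?mulr_ge0 ?nrm_ge0 ?ltW.
have hb x' y' : nrm x' <= 1 -> nrm y' <= 1 + e * t ->
    nrm (T x' y') <= 1 + e * t.
  move=> hx hy; apply: (le_trans (bf_le _ _ _)).
  have := nrm_ge0 x'; have := nrm_ge0 y'; have := nrm_ge0 T => p1 p2 p3.
  apply: le_trans hy; rewrite -[leRHS]mul1r ler_wpM2r//.
  by rewrite -[leRHS]mul1r ler_pM.
have hzN : nrm (x - c *: z) <= 1.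
  by rewrite -scaleNr; apply: hz; rewrite nrmN.
have := nrmD (T (x + c *: z) (y + t%:C *: w)) (T (x - c *: z) (y - t%:C *: w)).
rewrite E nrmM.
rewrite nrm_nat E3 => h3.
have h4 := hb _ _ (hz _ nc) h1; have h5 := hb _ _ hzN h2.
rewrite -lerBlDr ler_pdivlMr//; lra.
Qed.

(** The direction lies in the kernel of [f], so both [u + t w'] and [u - t w'] have norm at least 1;
    smoothness bounds their sum, hence each of them. *)
Lemma smooth_tangent (e : R) : uniformly_smooth X -> 0 < e ->
  exists2 t0 : R, 0 < t0 & forall t : R, 0 < t -> t <= t0 ->
    forall (v w : X) f, nrm v <= 1 -> nrm w <= 1 -> contractive_functional f ->
      f v = (nrm v)%:C ->
      nrm (v + t%:C *: (w - f w *: ((nrm v)^-1%:C *: v))) <= 1 + e * t.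
Proof.
move=> sm e0; have e2 : 0 < e / 2 by lra.
have [d d0 hd] := uniformly_smooth_real sm e2.
(* The bound [d / 2] accounts for [nrm w' <= 2]; the bound 1 settles [v = 0], where the direction is
   [w] itself. *)
exists (Num.min (d / 2) 1); first by rewrite lt_min ltr01 andbT; lra.
move=> t t0; rewrite le_min => /andP[td t1] v w f v1 w1 [fl fc] fv.
have [->|vn0] := eqVneq v 0.
  rewrite !scaler0 subr0 add0r nrmZr gtr0_norm//.
  have := nrm_ge0 w; nra.
set u := _ *: v; have u1 : nrm u = 1 by rewrite nrm_unit.
have vE : v = (nrm v)%:C *: u by rewrite nrm_unitK.
have fu : f u = 1.
  have na0 : nrm v != 0 by apply: contra_neq vn0 => /nrm_eq0.
  have f0 : f 0 = 0 by exact: contractive_functional0.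
  by rewrite /u -[_ *: v]addr0 fl fv f0 addr0 -rmorphM /= mulVf.
set w' := w - _; have fw' : f w' = 0.
  by rewrite /w' addrC -scaleNr fl fu mulr1 addNr.
have w'2 : nrm w' <= 2.
  apply: (le_trans (nrmBD _ _)); rewrite nrmZ u1 mulr1.
  by have := fc w; lra.
have ge1 (s : R[i]) : 1 <= nrm (u + s *: w').
  apply: le_trans (fc _); rewrite addrC fl fw' fu mulr0 add0r.
  by rewrite nrm1.
have := hd u (t%:C *: w') u1; rewrite nrmZr gtr0_norm//.
have tw : t * nrm w' <= d by have := nrm_ge0 w'; nra.
move=> /(_ tw).
have := ge1 t%:C; have := ge1 (- t%:C); rewrite scaleNr => g1 g2 g3.
have tw2 : t * nrm w' <= t * 2 by rewrite ler_pM2l.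
have tw3 : e / 2 * (t * nrm w') <= e * t by nra.
(* The moduli of the two weights add up to 1, so the bounds at the unit vector [u], for both signs,
   carry over to [v]. *)
have split_v z : v + z = ((1 + nrm v) / 2)%:C *: (u + z) -
    ((1 - nrm v) / 2)%:C *: (u - z).
  rewrite [in LHS]vE !scalerDr opprD scalerN opprK addrACA -scalerBl -scalerDl.
  have -> : ((1 + nrm v) / 2)%:C - ((1 - nrm v) / 2)%:C = (nrm v)%:C.
    by rewrite -rmorphB; congr (_%:C); field.
  have -> : ((1 + nrm v) / 2)%:C + ((1 - nrm v) / 2)%:C = 1.
    by rewrite -rmorphD -(rmorph1 (real_complex R)); congr (_%:C); field.
  by rewrite scale1r.
rewrite split_v.
apply: (le_trans (nrmBD _ _)); rewrite !nrmZr.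
have := nrm_ge0 v => v0.
rewrite !ger0_norm; [nra|lra|lra].
Qed.

(** The vector is [(|v| + i t r) u] with [u] of norm at most 1, and the modulus of the factor
    exceeds 1 only to second order in [t]. *)
Lemma rotation_tangent (e t r : R) (v : X) : 0 < t -> t <= e -> `|r| <= 1 ->
  nrm v <= 1 ->
  nrm (v + t%:C *: ('i *: (r%:C *: ((nrm v)^-1%:C *: v)))) <= 1 + e * t.
Proof.
move=> t0 te r1 v1.
move: (nrm_unit_le v) (esym (nrm_unitK v)).
move: ((nrm v)^-1%:C *: v) => u u1 vE.
rewrite {1}vE !scalerA -scalerDl nrmZ.
set a := (X in nrm X * _).
suff h : nrm a <= 1 + e * t.
  by have h2 := nrm_ge0 a; have h3 := nrm_ge0 u; nra.
have -> : a = nrm v +i* (t * r).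
  by apply/eqP; rewrite eq_complex /a /=; apply/andP; split; apply/eqP; ring.
rewrite nrmc /=.
have e20 : 0 <= 1 + e * t by nra.
rewrite -[leRHS](ger0_norm e20) -sqrtr_sqr ler_wsqrtr//.
have v0 := nrm_ge0 v.
have r2 : r ^+ 2 <= 1 by rewrite -real_normK ?num_real// expr_le1.
have t2 : t ^+ 2 <= e * t by nra.
have : (t * r) ^+ 2 <= t ^+ 2 by rewrite exprMn; have := sqr_ge0 t; nra.
nra.
Qed.

End complex_convexity.

(** * Smallness of a form on the coordinates where a near-maximiser is short *)

Section small_mass.
Context (R : realType) (X : normedModType R[i]).

(* The coordinatewise decomposition [w = (w - f(w) u) + Re f(w) u + i Im f(w) u],
   with [f] supporting [y] at [u = y / |y|], has, up to factors [i], summands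
   tangent to the ball at [y]. *)
Lemma complex_convexity (g : R) : uniformly_smooth X -> 0 < g ->
  exists2 eta : R, 0 < eta &
    forall (Z : normedModType R[i]) (T : bilin_form Z (c0 X)) x y z w,
      nrm T <= 1 -> nrm y <= 1 -> 1 - eta < nrm (T x y) ->
      (forall c, nrm c = 1 -> nrm (x + c *: z) <= 1) ->
      nrm w <= 1 -> nrm (T z w) <= g.
Proof.
(* Each of the three summands of [w] will contribute at most [2 e]. *)
move=> sm g0; have e0 : 0 < g / 6 by lra.
have [t0 t00 ht] := smooth_tangent sm e0.
set e := g / 6 in e0 ht *.
pose t := Num.min t0 e.
have tp : 0 < t by rewrite lt_min t00 e0.
have te : t <= e by rewrite ge_min lexx orbT.
have tt0 : t <= t0 by rewrite ge_min lexx.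
(* With this value the bound [eta / t + e] of [tangent_bound] becomes [2 e]. *)
exists (e * t); first by rewrite mulr_gt0.
move=> Z T x y z w T1 y1 hT hz w1.
have y1' j : nrm (y j) <= 1 by apply: le_trans y1; exact: nrm_c0_coord.
have w1' j : nrm (w j) <= 1 by apply: le_trans w1; exact: nrm_c0_coord.
have tan w' : nrm (y + t%:C *: w') <= 1 + e * t ->
    nrm (y - t%:C *: w') <= 1 + e * t -> nrm (T z w') <= 2 * e.
  move=> h1 h2; have := tangent_bound tp T1 hT hz h1 h2.
  by rewrite mulfK ?gt_eqF//; lra.
have /choice[f hf] j : exists f, contractive_functional f /\
    f (y j) = (nrm (y j))%:C.
  by have [f] := support_functional (y j) sm; exists f.
pose u j := (nrm (y j))^-1%:C *: y j.
have u1 j : nrm (u j) <= 1 by exact: nrm_unit_le.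
pose F2 j v := (complex.Re (f j v))%:C *: u j.
pose F3 j v := (complex.Im (f j v))%:C *: u j.
pose F1 j v := v - f j v *: u j.
have nu (c : R[i]) v j : nrm c <= nrm v -> nrm (c *: u j) <= nrm v.
  move=> cv; rewrite nrmZ -[leRHS]mulr1.
  by apply: ler_pM; rewrite ?nrm_ge0.
have b2 j v : nrm (F2 j v) <= 1 * nrm v.
  rewrite mul1r nu// nrmR; apply: le_trans (normRe_le_nrm _) _.
  exact: (hf j).1.2.
have b3 j v : nrm (F3 j v) <= 1 * nrm v.
  rewrite mul1r nu// nrmR; apply: le_trans (Im_le_nrm _) _.
  exact: (hf j).1.2.
have b1 j v : nrm (F1 j v) <= 2 * nrm v.
  apply: (le_trans (nrmBD _ _)); rewrite mulr_natl mulr2n lerD2l nu//.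
  exact: (hf j).1.2.
have wE : w = coordmap F1 w + (coordmap F2 w + 'i *: coordmap F3 w).
  apply: c0_ext => j.
  have -> : (coordmap F1 w + (coordmap F2 w + 'i *: coordmap F3 w)) j =
    coordmap F1 w j + (coordmap F2 w j + 'i *: coordmap F3 w j) by [].
  rewrite (coordmapE _ _ b1) (coordmapE _ _ b2) (coordmapE _ _ b3).
  rewrite /F1 /F2 /F3; move: (u j) (f j (w j)) => v a.
  by rewrite scalerA -scalerDl -complexE subrK.
have c1 : nrm (T z (coordmap F1 w)) <= 2 * e.
  apply: tan; apply: nrm_c0_le => j.
    have -> : (y + t%:C *: coordmap F1 w) j =
      y j + t%:C *: coordmap F1 w j by [].
    by rewrite (coordmapE _ _ b1); apply: ht => //; case: (hf j).
  have -> : (y - t%:C *: coordmap F1 w) j =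
    y j + t%:C *: - coordmap F1 w j by rewrite scalerN.
  rewrite (coordmapE _ _ b1).
  have -> : - F1 j (w j) = F1 j (- w j).
    have f0 := contractive_functional0 (hf j).1.
    have := (hf j).1.1 (-1) (w j) 0; rewrite scaleN1r !addr0 f0 addr0 mulN1r.
    by rewrite /F1 => ->; rewrite opprB scaleNr opprK addrC.
  by apply: ht; rewrite ?nrmN//; case: (hf j).
(* Multiplying by ['i] leaves the modulus of the value of [T] unchanged and turns a real multiple of
   [u j] into a tangent direction. *)
have rot F : (forall j v, nrm (F j v) <= 1 * nrm v) ->
    (forall j, exists2 r : R, `|r| <= 1 & F j (w j) = r%:C *: u j) ->
    nrm (T z (coordmap F w)) <= 2 * e.
  move=> bF hF.
  have <- : nrm (T z ('i *: coordmap F w)) = nrm (T z (coordmap F w)).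
    by rewrite bf_Zr nrmM nrmi mul1r.
  apply: tan; apply: nrm_c0_le => j; have [r r1 rE] := hF j.
    have -> : (y + t%:C *: ('i *: coordmap F w)) j =
      y j + t%:C *: ('i *: coordmap F w j) by [].
    by rewrite (coordmapE _ _ bF) rE; exact: rotation_tangent.
  have -> : (y - t%:C *: ('i *: coordmap F w)) j =
    y j - t%:C *: ('i *: coordmap F w j) by [].
  rewrite (coordmapE _ _ bF) rE.
  have -> : - (t%:C *: ('i *: (r%:C *: u j))) =
      t%:C *: ('i *: ((- r)%:C *: u j)).
    by rewrite rmorphN scaleNr !scalerN.
  by apply: rotation_tangent => //; rewrite normrN.
have c2 : nrm (T z (coordmap F2 w)) <= 2 * e.
  apply: rot => // j; exists (complex.Re (f j (w j))) => //.
  apply: le_trans (normRe_le_nrm _) _.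
  by apply: le_trans (w1' j); exact: (hf j).1.2.
have c3 : nrm (T z (coordmap F3 w)) <= 2 * e.
  apply: rot => // j; exists (complex.Im (f j (w j))) => //.
  apply: le_trans (Im_le_nrm _) _.
  by apply: le_trans (w1' j); exact: (hf j).1.2.
rewrite wE !bf_Dr bf_Zr.
apply: (le_trans (nrmD _ _)).
have := nrmD (T z (coordmap F2 w)) ('i * T z (coordmap F3 w)).
by rewrite nrmM nrmi mul1r; rewrite /e in c1 c2 c3; lra.
Qed.

Lemma bf_flip (Z W : normedModType R[i]) (T : bilin_form Z W) :
  exists2 T' : bilin_form W Z, nrm T' <= nrm T & forall x y, T' x y = T y x.
Proof.
have [|||T' T'E] := @bf_mk R W Z (fun x y => T y x) (nrm T).
- by move=> a x x' y; rewrite bf_linr.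
- by move=> a x y y'; rewrite bf_linl.
- by move=> x y x1 y1; exact: bf_ball.
exists T' => //; apply: bf_norm_le => x y x1 y1; rewrite T'E; exact: bf_ball.
Qed.

Lemma small_mass_left (g d : R) : uniformly_smooth X -> 0 < g -> 0 < d ->
  exists2 eta : R, 0 < eta &
    forall (T : bilin_form (c0 X) (c0 X)) x y (D : pred nat) z w,
      nrm T <= 1 -> nrm x <= 1 -> nrm y <= 1 -> 1 - eta < nrm (T x y) ->
      (forall i, D i -> nrm (x i) <= 1 - d) ->
      nrm z <= 1 -> nrm w <= 1 -> nrm (T (restrict D z) w) <= g.
Proof.
(* The perturbation has to be scaled by [d] to stay in the ball; the tolerance [g * d] compensates
   for that factor. *)
move=> sm g0 d0; have gd0 : 0 < g * d by rewrite mulr_gt0.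
have [eta eta0 h] := complex_convexity sm gd0.
exists eta => // T x y D z w T1 x1 y1 hT hD z1 w1.
suff : nrm (T (d%:C *: restrict D z) w) <= g * d.
  by rewrite bf_Zl nrmM nrmR gtr0_norm// mulrC ler_pM2r.
apply: h hT _ w1 => // c c1; apply: nrm_c0_le => i.
have -> : (x + c *: (d%:C *: restrict D z)) i =
  x i + c *: (d%:C *: restrict D z i) by [].
rewrite restrictE; case: ifP => Di; last first.
  by rewrite !scaler0 addr0; apply: le_trans x1; exact: nrm_c0_coord.
apply: (le_trans (nrmD _ _)); rewrite nrmZ c1 mul1r nrmZr gtr0_norm//.
have := hD i Di; have : nrm (z i) <= 1 by apply: le_trans z1; exact: nrm_c0_coord.
nra.
Qed.

(** One [eta] serves both variables: the second implication is the first one for the transposed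
    form. *)
Lemma small_mass (g d : R) : uniformly_smooth X -> 0 < g -> 0 < d ->
  exists2 eta : R, 0 < eta &
    forall (T : bilin_form (c0 X) (c0 X)) x y (D E : pred nat) z w,
      nrm T <= 1 -> nrm x <= 1 -> nrm y <= 1 -> 1 - eta < nrm (T x y) ->
      nrm z <= 1 -> nrm w <= 1 ->
      ((forall i, D i -> nrm (x i) <= 1 - d) -> nrm (T (restrict D z) w) <= g) /\
      ((forall i, E i -> nrm (y i) <= 1 - d) -> nrm (T z (restrict E w)) <= g).
Proof.
move=> sm g0 d0; have [eta eta0 h] := small_mass_left sm g0 d0.
exists eta => // T x y D E z w T1 x1 y1 hT z1 w1; split=> [hD|hE].
  exact: h hT hD z1 w1.
have [T' T'T T'E] := bf_flip T; rewrite -T'E; rewrite -T'E in hT.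
by apply: h hT hE w1 z1 => //; exact: le_trans T1.
Qed.

End small_mass.

(** * Strongly exposed points *)

Section exposing.
Context (R : realType) (X : normedModType R[i]).
Implicit Types (x y z : c0 X) (s : seq nat).

(** If [nrm (x + y)] is almost 2, both vectors are almost unit vectors; normalising them changes
    distance and sum by at most [2 m], and the modulus on the sphere applies. *)
Lemma uniformly_convex_ball (e : R) : uniformly_convex X -> 0 < e ->
  exists2 d : R, 0 < d & forall x y : X, nrm x <= 1 -> nrm y <= 1 ->
    e <= nrm (x - y) -> nrm (x + y) <= 2 - d.
Proof.
move=> uc e0; pose e' := Num.min (e / 2) 2.
have e'0 : 0 < e' by rewrite lt_min ltr0n andbT; lra.
have e'2 : e' <= 2 by rewrite ge_min lexx orbT.
have e'e : e' <= e / 2 by rewrite ge_min lexx.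
have [|d d0 hd] := uc e'; first by rewrite e'0 e'2.
(* The three bounds keep the normalised vectors [e / 2] apart, keep the gain [2 d] ahead of the loss
   [2 m], and keep the vectors nonzero. *)
pose m := Num.min (Num.min (e / 4) (d / 2)) 2^-1.
have m0 : 0 < m by rewrite !lt_min; apply/andP; split; [apply/andP; split|]; lra.
have [m1 [m2 m3]] : m <= e / 4 /\ m <= d / 2 /\ m <= 2^-1.
  by rewrite /m !ge_min !lexx ?orbT.
exists m => // x y x1 y1 exy; rewrite leNgt; apply/negP => hxy.
have := nrmD x y => tri.
have near_unit (v : X) : nrm v <= 1 -> 1 - m < nrm v ->
    nrm ((nrm v)^-1%:C *: v) = 1 /\ nrm (v - (nrm v)^-1%:C *: v) <= m.
  move=> v1 vm.
  have v0 : v != 0 by apply/eqP => v0; move: vm; rewrite v0 nrm0; lra.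
  have h := nrm_unit v0; split=> //.
  have -> : v - (nrm v)^-1%:C *: v = (nrm v - 1)%:C *: ((nrm v)^-1%:C *: v).
    by rewrite rmorphB scalerBl nrm_unitK rmorph1 scale1r.
  by rewrite nrmZr h mulr1 ler0_norm; lra.
have [|hx hxm] := near_unit x x1; first by lra.
have [|hy hym] := near_unit y y1; first by lra.
move: (_ *: x) (_ *: y) hx hxm hy hym => x' y' hx hxm hy hym.
have h1 : nrm (x - y) <= nrm (x - x') + nrm (x' - y') + nrm (y - y').
  apply: (le_trans (nrm_tri _ x' _)); rewrite -addrA lerD2l.
  by apply: (le_trans (nrm_tri _ y' _)); rewrite lerD2l nrmB.
have h2 : nrm (x + y) <= nrm (x - x') + nrm (x' + y') + nrm (y - y').
  have -> : x + y = (x - x') + (x' + y') + (y - y').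
    by rewrite [_ + (x' + y')]addrA subrK -addrA [y' + _]addrC subrK.
  by apply: (le_trans (nrmD _ _)); rewrite lerD2r nrmD.
have : nrm (2^-1 *: (x' + y')) <= 1 - d.
  rewrite -lecR -nrmE; apply: hd; try exact/unit_sphereE.
  by rewrite nrmE lecR; lra.
rewrite nrmZ nrmV nrm_nat//.
by rewrite mulrC ler_pdivrMr//; lra.
Qed.

(** Since [f v = 1], the norm of [w + v] is at least [1 + Re (f w) > 2 - d], so uniform convexity
    brings [w] close to [v], with the same [d] for all [v] and [f]. *)
Lemma strongly_exposed (e : R) : uniformly_convex X -> 0 < e ->
  exists2 d : R, 0 < d & forall (v w : X) f, contractive_functional f ->
    f v = 1 -> nrm v <= 1 -> nrm w <= 1 -> 1 - d < complex.Re (f w) ->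
    nrm (w - v) < e.
Proof.
move=> uc e0; have [d d0 hd] := uniformly_convex_ball uc e0.
exists d => // v w f [fl fc] fv v1 w1 hw; rewrite ltNge; apply/negP => h.
have := hd w v w1 v1 h.
have : complex.Re (f (w + v)) <= nrm (w + v).
  exact: le_trans (Re_le_nrm _) (fc _).
rewrite -[w]scale1r fl fv mul1r scale1r raddfD /=.
lra.
Qed.

(** For uniformly convex [X] these are the extreme points of the unit ball of the sequences
    supported in [s]. *)
Definition extremal s x :=
  (forall i, i \notin s -> x i = 0) /\ (forall i, i \in s -> nrm (x i) = 1).

Lemma extremal_le1 s x : extremal s x -> nrm x <= 1.
Proof.
move=> [h0 h1]; apply: nrm_c0_le => i.
by have [/h1->|/h0->] := boolP (i \in s); rewrite // nrm0.
Qed.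

Lemma extremalZ s x (c : R[i]) : nrm c = 1 -> extremal s x ->
  extremal s (c *: x).
Proof.
move=> c1 [h0 h1]; split=> i si; have -> : (c *: x) i = c *: x i by [].
  by rewrite h0// scaler0.
by rewrite nrmZ c1 mul1r h1.
Qed.

(** [phi] averages support functionals of the coordinates of [x]; repeated entries of [s] are
    weighted by multiplicity. *)
Lemma average_functional s x : uniformly_smooth X -> (0 < size s)%N ->
  extremal s x ->
  exists f : nat -> X -> R[i],
    let phi z := (size s)%:R^-1%:C * \sum_(i <- s) f i (z i) in
    [/\ forall i, contractive_functional (f i),
        forall i, i \in s -> f i (x i) = 1,
        contractive_functional phi & phi x = 1].
Proof.
move=> sm s0 [_ x1]; have n0 : 0 < (size s)%:R :> R by rewrite ltr0n.
have /choice[f hf] i : exists f, contractive_functional f /\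
    f (x i) = (nrm (x i))%:C.
  by have [f] := support_functional (x i) sm; exists f.
have fx i : i \in s -> f i (x i) = 1 by move=> /x1 h; rewrite (hf i).2 h.
exists f => phi; split=> //; first by move=> i; exact: (hf i).1.
  split=> [a z w|z].
    rewrite /phi [a * (_ * _)]mulrCA -mulrDr; congr (_ * _).
    by rewrite mulr_sumr -big_split /=; apply: eq_bigr => i _; exact: (hf i).1.1.
  rewrite /phi nrmM nrmR ger0_norm ?invr_ge0 ?ler0n// mulrC ler_pdivrMr//.
  apply: (le_trans (nrm_sum _ _ _)).
  have -> : nrm z * (size s)%:R = \sum_(i <- s) nrm z.
    by rewrite big_const_seq count_predT iter_addr_0 mulr_natr.
  by apply: ler_sum => i _; apply: le_trans (nrm_c0_coord _ i); exact: (hf i).1.2.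
rewrite /phi big_seq (eq_bigr (fun=> 1)); last by move=> i /fx.
rewrite -big_seq big_const_seq count_predT iter_addr_0.
by rewrite -(rmorph_nat (real_complex R) (size s)) -rmorphM /= mulVf ?gt_eqF.
Qed.

Lemma extremal_exposed (e : R) s : uniformly_convex X -> uniformly_smooth X ->
  (0 < size s)%N -> 0 < e ->
  exists2 d : R, 0 < d & forall x, extremal s x ->
    exists phi : c0 X -> R[i],
      [/\ contractive_functional phi, phi x = 1,
          forall z, phi (restrict (mem s) z) = phi z &
          forall z, extremal s z -> 1 - d < nrm (phi z) ->
            exists2 c, nrm c = 1 & nrm (c *: z - x) <= e].
Proof.
move=> uc sm s0 e0; have [d d0 hd] := strongly_exposed uc e0.
have n0 : 0 < (size s)%:R :> R by rewrite ltr0n.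
(* The defects [1 - Re (f i (c z i))] are nonnegative; if their average is below this value, each of
   them is below [d]. *)
exists (d / (size s)%:R); first by rewrite divr_gt0.
move=> x xs; have [f [fc fx phic phix]] := average_functional sm s0 xs.
exists (fun z => (size s)%:R^-1%:C * \sum_(i <- s) f i (z i)); split=> //.
  move=> z; congr (_ * _); rewrite big_seq [RHS]big_seq.
  by apply: eq_bigr => i si; rewrite restrictE /= si.
move=> z zs hz.
have [c c1 cz] := phase ((size s)%:R^-1%:C * \sum_(i <- s) f i (z i)).
exists c => //; apply: nrm_c0_le => i.
have -> : (c *: z - x) i = c *: z i - x i by [].
have [si|si] := boolP (i \in s); last first.
  by rewrite zs.1// xs.1// scaler0 subr0 nrm0 ltW.
apply: ltW; apply: (hd _ _ (f i)) => //; first exact: fx.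
- by rewrite xs.2.
- by rewrite nrmZ c1 mul1r zs.2.
set p := nrm _ in cz hz.
have fcZ j : f j (c *: z j) = c * f j (z j).
  have := (fc j).1 c (z j) 0.
  by rewrite (contractive_functional0 (fc j)) !addr0.
have Rsum : \sum_(j <- s) complex.Re (f j (c *: z j)) = (size s)%:R * p.
  rewrite -[LHS](raddf_sum (@complex.Re R)) -[RHS]/(complex.Re ((size s)%:R * p)%:C).
  congr complex.Re; rewrite rmorphM /= -cz mulrCA [_%:C * (_ * _)]mulrA.
  rewrite -rmorphM /= divff ?gt_eqF//.
  by rewrite rmorph1 mul1r mulr_sumr; apply: eq_bigr.
have ub j : j \in s -> 0 <= 1 - complex.Re (f j (c *: z j)).
  move=> js; rewrite subr_ge0; apply: le_trans (Re_le_nrm _) _.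
  by apply: le_trans ((fc j).2 _) _; rewrite nrmZ c1 mul1r zs.2.
have sumE : \sum_(j <- s) (1 - complex.Re (f j (c *: z j))) =
    (size s)%:R * (1 - p).
  by rewrite sumrB big_const_seq count_predT iter_addr_0 mulrBr mulr1 Rsum.
have : 1 - complex.Re (f i (c *: z i)) <=
    \sum_(j <- s) (1 - complex.Re (f j (c *: z j))).
  rewrite (big_rem i si) /= lerDl big_seq sumr_ge0// => j /mem_rem; exact: ub.
have : (size s)%:R * (1 - p) < d by rewrite mulrC -ltr_pdivlMr//; lra.
rewrite sumE; lra.
Qed.

Lemma convex_max (a b : R[i]) (r : R) : 0 <= r <= 1 ->
  nrm (a + r%:C * b) <= Num.max (nrm (a + b)) (nrm (a - b)).
Proof.
move=> /andP[r0 r1].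
have -> : a + r%:C * b = ((1 + r) / 2)%:C * (a + b) + ((1 - r) / 2)%:C * (a - b).
  have -> : ((1 - r) / 2)%:C = 1 - ((1 + r) / 2)%:C.
    by rewrite -(rmorph1 (real_complex R)) -rmorphB; congr (_%:C); field.
  have -> : r%:C = ((1 + r) / 2)%:C * 2 - 1.
    rewrite -(rmorph1 (real_complex R)) -(rmorph_nat (real_complex R)).
    by rewrite -rmorphM -rmorphB; congr (_%:C); field.
  ring.
apply: (le_trans (nrmD _ _)); rewrite !nrmM !nrmR.
rewrite !ger0_norm; [|lra|lra].
have h1 : nrm (a + b) <= Num.max (nrm (a + b)) (nrm (a - b)).
  by rewrite le_max lexx.
have h2 : nrm (a - b) <= Num.max (nrm (a + b)) (nrm (a - b)).
  by rewrite le_max lexx orbT.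
move: (Num.max _ _) h1 h2 => m; nra.
Qed.

Definition c0_finite s (f : nat -> X) : c0 X :=
  insubd (0 : c0 X) (fun i => if i \in s then f i else 0).

Lemma c0_finiteE s f i : c0_finite s f i = if i \in s then f i else 0.
Proof.
rewrite /c0_finite.
suff /(insubdK (0 : c0 X)) :
    (fun i => if i \in s then f i else 0) \in @null_seq _ X by move=> /= ->.
apply: null_seq_small => e e0; exists (\max_(j <- s) j).+1 => j hj.
rewrite ifF ?nrm0//; apply/negP => js; move: hj.
by rewrite ltnNge (leq_bigmax_seq j js).
Qed.

(** Coordinates are brought to norm 1 one at a time. If [x' i = r v] with [nrm v = 1] and
    [0 <= r <= 1], convexity allows replacing it by [v] or [- v] without decreasing [nrm (g x')].
    The unit vector [u] provides [v] when [x' i = 0]. *)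
Lemma extremal_dominates s (g : c0 X -> R[i]) x : (exists u : X, nrm u = 1) ->
  (forall a z w, g (a *: z + w) = a * g z + g w) ->
  (forall z, g (restrict (mem s) z) = g z) -> nrm x <= 1 ->
  exists2 x', extremal s x' & nrm (g x) <= nrm (g x').
Proof.
move=> [u u1] gl gs x1.
have : forall t : seq nat, exists x', [/\ nrm x' <= 1,
    forall i, i \in t -> nrm (x' i) = 1 & nrm (g x) <= nrm (g x')].
  elim=> [|i t [x' [x'1 x't gx']]]; first by exists x.
  have [v v1 vE] : exists2 v, nrm v = 1 & x' i = (nrm (x' i))%:C *: v.
    have [->|x'0] := eqVneq (x' i) 0; first by exists u; rewrite ?nrm0 ?scale0r.
    by exists ((nrm (x' i))^-1%:C *: x' i); rewrite ?nrm_unit ?nrm_unitK.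
  pose dl := c0_finite [:: i] (fun=> v).
  pose b := x' - (nrm (x' i))%:C *: dl.
  have bE j : b j = if j == i then 0 else x' j.
    have -> : b j = x' j - (nrm (x' i))%:C *: dl j by [].
    rewrite c0_finiteE inE; case: eqP => [->|_]; first by rewrite -vE subrr.
    by rewrite scaler0 subr0.
  have good (c : R[i]) : nrm c = 1 -> nrm (c *: dl + b) <= 1 /\
      forall j, j \in i :: t -> nrm ((c *: dl + b) j) = 1.
    move=> c1; have cE j : (c *: dl + b) j = if j == i then c *: v else x' j.
      have -> : (c *: dl + b) j = c *: dl j + b j by [].
      by rewrite bE c0_finiteE inE; case: eqP; rewrite ?addr0// scaler0 add0r.
    split=> [|j]; first apply: nrm_c0_le => j.
      rewrite cE; case: eqP => _; first by rewrite nrmZ c1 v1 mulr1.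
      by apply: le_trans x'1; exact: nrm_c0_coord.
    rewrite cE inE; case: eqP => [_ _|_ /= /x't//].
    by rewrite nrmZ c1 v1 mulr1.
  have hmax : nrm (g x') <= Num.max (nrm (g b + g dl)) (nrm (g b - g dl)).
    have -> : g x' = g b + (nrm (x' i))%:C * g dl.
      by rewrite addrC -gl addrC subrK.
    apply: convex_max; rewrite nrm_ge0 /=.
    by apply: le_trans x'1; exact: nrm_c0_coord.
  have g1 : g (1 *: dl + b) = g b + g dl by rewrite gl mul1r addrC.
  have g2 : g (-1 *: dl + b) = g b - g dl by rewrite gl mulN1r addrC.
  have n1 : nrm (-1 : R[i]) = 1 by rewrite nrmN nrm1.
  move: hmax; rewrite -g1 -g2 le_max => /orP[h|h].
    have [h1 h2] := good 1 (nrm1 R).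
    by exists (1 *: dl + b); split=> //; exact: le_trans h.
  have [h1 h2] := good (-1) n1.
  by exists (-1 *: dl + b); split=> //; exact: le_trans h.
move=> /(_ s)[x' [x'1 x's gx']].
exists (restrict (mem s) x'); last by rewrite gs.
by split=> i si; rewrite restrictE /= ?si ?(negPf si)// x's.
Qed.

End exposing.

Lemma geometric_le0 (R : realType) (a C : R) :
  (forall k, a <= C * 2^-1 ^+ k) -> a <= 0.
Proof.
move=> h; rewrite leNgt; apply/negP => a0.
have [k] := bound_cvg0 C a0; have := h k; lra.
Qed.

(** * Norm-attaining forms *)

Section form_limit.
Context (R : realType) (X : completeNormedModType R[i]) (u : X).
Context (sm : uniformly_smooth X) (u1 : nrm u = 1).

(* [R[i]] has no canonical completeness instance, so the limit is taken along
   the line spanned by [u] in [X]. *)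
Lemma complex_geometric_cvg (a : nat -> R[i]) (C : R) :
  (forall k, nrm (a k.+1 - a k) <= C * 2^-1 ^+ k) ->
  exists l, forall k, nrm (a k - l) <= 2 * C * 2^-1 ^+ k.
Proof.
move=> h; have [k|l hl] := @geometric_cvg R X (fun k => a k *: u) C.
  by rewrite -scalerBl nrmZ u1 mulr1.
have [f fP fu] := support_functional u sm; have [fl fc] := fP.
exists (f l) => k; apply: le_trans (hl k).
have -> : a k - f l = f (a k *: u - l).
  have := fl (-1) l (a k *: u); rewrite scaleN1r mulN1r addrC => ->.
  have := fl (a k) u 0.
  by rewrite contractive_functional0// !addr0 fu u1 mulr1 => ->; rewrite addrC.
exact: fc.
Qed.

Lemma bf_geometric_cvg (Z W : normedModType R[i]) (T : nat -> bilin_form Z W)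
    (C : R) :
  (forall k, nrm (T k.+1 - T k) <= C * 2^-1 ^+ k) ->
  exists G : bilin_form Z W, forall k, nrm (T k - G) <= 2 * C * 2^-1 ^+ k.
Proof.
move=> h.
have pt x y k : nrm (T k.+1 x y - T k x y) <= C * nrm x * nrm y * 2^-1 ^+ k.
  rewrite -bf_subE; apply: (le_trans (bf_le _ _ _)).
  have -> : C * nrm x * nrm y * 2^-1 ^+ k =
    C * 2^-1 ^+ k * nrm x * nrm y by ring.
  by do 2 (apply: ler_wpM2r; first exact: nrm_ge0).
have /choice[g' hg'] (p : Z * W) : exists l, forall k,
    nrm (T k p.1 p.2 - l) <= 2 * (C * nrm p.1 * nrm p.2) * 2^-1 ^+ k.
  exact: complex_geometric_cvg (pt p.1 p.2).
pose g x y := g' (x, y).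
have hg x y k : nrm (T k x y - g x y) <= 2 * (C * nrm x * nrm y) * 2^-1 ^+ k.
  exact: hg' (x, y) k.
(* Each [T k] is bilinear, so the defect of linearity of [g] is a combination of errors [T k - g]
   and is of order [2^-k] for every [k]. *)
have zero (b : R[i]) (D : R) : (forall k, nrm b <= D * 2^-1 ^+ k) -> b = 0.
  by move=> /geometric_le0 b0; apply: nrm_eq0; apply/le_anti; rewrite b0 nrm_ge0.
have C0 : 0 <= C.
  by have := h 0%N; rewrite expr0 mulr1; apply: le_trans; exact: nrm_ge0.
have [||x y x1 y1|G GE] := @bf_mk R Z W g (nrm (T 0%N) + 2 * C).
- move=> a x x' y; apply/eqP; rewrite -subr_eq0; apply/eqP.
  apply: zero => k.
  have -> : g (a *: x + x') y - (a * g x y + g x' y) =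
      a * (T k x y - g x y) + (T k x' y - g x' y) -
      (T k (a *: x + x') y - g (a *: x + x') y).
    by rewrite bf_linl; ring.
  apply: (le_trans (nrmBD _ _)); apply: (le_trans (lerD (nrmD _ _) (hg _ _ _))).
  rewrite nrmM.
  apply: (le_trans (lerD
    (lerD (ler_wpM2l (nrm_ge0 _) (hg _ _ _)) (hg _ _ _)) (lexx _))).
  rewrite [nrm a * _]mulrA -!mulrDl; exact: lexx.
- move=> a x y y'; apply/eqP; rewrite -subr_eq0; apply/eqP.
  apply: zero => k.
  have -> : g x (a *: y + y') - (a * g x y + g x y') =
      a * (T k x y - g x y) + (T k x y' - g x y') -
      (T k x (a *: y + y') - g x (a *: y + y')).
    by rewrite bf_linr; ring.
  apply: (le_trans (nrmBD _ _)); apply: (le_trans (lerD (nrmD _ _) (hg _ _ _))).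
  rewrite nrmM.
  apply: (le_trans (lerD
    (lerD (ler_wpM2l (nrm_ge0 _) (hg _ _ _)) (hg _ _ _)) (lexx _))).
  rewrite [nrm a * _]mulrA -!mulrDl; exact: lexx.
- have -> : g x y = T 0%N x y - (T 0%N x y - g x y) by rewrite opprB addrC subrK.
  apply: (le_trans (nrmBD _ _)); apply: lerD; first exact: bf_ball.
  apply: (le_trans (hg _ _ _)); rewrite expr0 mulr1 ler_pM2l// -mulrA.
  by rewrite -[leRHS]mulr1 ler_wpM2l// mulr_ile1// nrm_ge0.
exists G => k; apply: bf_norm_le => x y x1 y1; rewrite bf_subE GE.
apply: (le_trans (hg _ _ _)); rewrite ler_wpM2r ?exprn_ge0// ler_pM2l//.
by rewrite -mulrA -[leRHS]mulr1 ler_wpM2l// mulr_ile1// nrm_ge0.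
Qed.

End form_limit.

(** * Density of norm-attaining forms among the finitely supported ones *)

Section norm_attaining.
Context (R : realType) (X : completeNormedModType R[i]).
Local Notation form := (bilin_form (c0 X) (c0 X)).
Implicit Types (T G : form) (s : seq nat).

Definition supported s s' T :=
  forall x y, T (restrict (mem s) x) (restrict (mem s') y) = T x y.

Lemma supported_l s s' T x y : supported s s' T ->
  T (restrict (mem s) x) y = T x y.
Proof.
move=> h; rewrite -h -[RHS]h; congr (T _ _).
by apply: c0_ext => i; rewrite !restrictE; case: (mem _ i).
Qed.

Lemma supported_r s s' T x y : supported s s' T ->
  T x (restrict (mem s') y) = T x y.
Proof.
move=> h; rewrite -h -[RHS]h; congr (T _ _).
by apply: c0_ext => i; rewrite !restrictE; case: (mem _ i).
Qed.

Lemma near_norm_extremal s s' T (e : R) : (exists u : X, nrm u = 1) ->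
  supported s s' T -> 0 < e ->
  exists x y, [/\ extremal s x, extremal s' y & nrm T - e < nrm (T x y)].
Proof.
move=> u h e0; have [x [y [x1 y1 hxy]]] := bf_near_norm T e0.
have [||z zs hz] := @extremal_dominates R X s (fun z => T z y) x u _ _ x1.
- by move=> a z w; rewrite bf_linl.
- by move=> z; exact: supported_l h.
have [||w ws hw] := @extremal_dominates R X s' (fun w => T z w) y u _ _ y1.
- by move=> a w w'; rewrite bf_linr.
- by move=> w; exact: supported_r h.
by exists z, w; split=> //; apply: lt_le_trans hxy _; apply: le_trans hz hw.
Qed.

Lemma rank_one_form (Z W : normedModType R[i]) (f : Z -> R[i]) (g : W -> R[i])
    (a : R[i]) :
  contractive_functional f -> contractive_functional g ->
  exists2 T : bilin_form Z W, nrm T <= nrm a &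
    forall x y, T x y = a * (f x * g y).
Proof.
move=> [fl fc] [gl gc].
have b x y : nrm x <= 1 -> nrm y <= 1 -> nrm (a * (f x * g y)) <= nrm a.
  move=> x1 y1; rewrite nrmM -[leRHS]mulr1 ler_wpM2l ?nrm_ge0// nrmM.
  rewrite mulr_ile1 ?nrm_ge0//; first exact: le_trans (fc _) _.
  exact: le_trans (gc _) _.
have [|||T TE] := @bf_mk R Z W (fun x y => a * (f x * g y)) (nrm a).
- by move=> c x x' y; rewrite fl; ring.
- by move=> c x y y'; rewrite gl; ring.
- exact: b.
by exists T => //; apply: bf_norm_le => x y x1 y1; rewrite TE; exact: b.
Qed.

(** Adding [e] times the product of functionals exposing [x] and [y], in phase with [T x y], raises
    the value at [(x, y)] by [e]. A near-maximiser of the new form must then almost maximise both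
    functionals, so after rotations it is close to [(x, y)]. *)
Lemma lindenstrauss_step s s' (e t : R) :
  uniformly_convex X -> uniformly_smooth X -> (exists u : X, nrm u = 1) ->
  (0 < size s)%N -> (0 < size s')%N -> 0 < e -> 0 < t ->
  exists2 d : R, 0 < d & forall T x y (m m' : R),
    supported s s' T -> extremal s x -> extremal s' y ->
    nrm T - m < nrm (T x y) -> 0 < m' -> m + m' <= d ->
    exists T' x' y',
      [/\ supported s s' T', extremal s x', extremal s' y' &
          nrm T' - m' < nrm (T' x' y')] /\
      [/\ nrm (T' - T) <= e, nrm (x' - x) <= t & nrm (y' - y) <= t].
Proof.
move=> uc sm u s0 s'0 e0 t0.
have [d d0 hd] := extremal_exposed uc sm s0 t0.
have [d' d'0 hd'] := extremal_exposed uc sm s'0 t0.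
exists (e * Num.min d d'); first by rewrite mulr_gt0// lt_min d0.
move=> T x y m m' Ts xs ys Txy m'0 mm'.
have [f [fP fx fs hf]] := hd x xs.
have [g [gP gy gs hg]] := hd' y ys.
have [c c1 cT] := phase (T x y).
have c0 : c != 0 by apply/eqP => c0; move: c1; rewrite c0 nrm0; lra.
have [Q Qe QE] := rank_one_form (e%:C / c) fP gP.
have nQ : nrm (e%:C / c) = e by rewrite nrmM nrmV nrmR c1 invr1 mulr1 gtr0_norm.
rewrite nQ in Qe.
have T's : supported s s' (T + Q).
  by move=> z w; rewrite !bf_addE Ts !QE fs gs.
have [x' [y' [x's y's hxy']]] := near_norm_extremal u T's m'0.
have T'xy : nrm ((T + Q) x y) = nrm (T x y) + e.
  rewrite bf_addE QE fx gy !mulr1 -[LHS]mul1r -c1 -nrmM mulrDr cT.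
  rewrite [c * _]mulrC divfK// -rmorphD nrmR ger0_norm//.
  by rewrite addr_ge0 ?nrm_ge0 ?ltW.
have T'n := bf_ball (T + Q) (extremal_le1 xs) (extremal_le1 ys).
have Tn' := bf_ball T (extremal_le1 x's) (extremal_le1 y's).
have up : nrm ((T + Q) x' y') <= nrm T + e * (nrm (f x') * nrm (g y')).
  rewrite bf_addE QE; apply: (le_trans (nrmD _ _)).
  by rewrite nrmM nQ nrmM lerD2r.
have fn : nrm (f x') <= 1 by apply: le_trans (fP.2 _) (extremal_le1 x's).
have gn : nrm (g y') <= 1 by apply: le_trans (gP.2 _) (extremal_le1 y's).
have f0 := nrm_ge0 (f x'); have g0 := nrm_ge0 (g y').
have fg : 1 - Num.min d d' < nrm (f x') * nrm (g y').
  by rewrite -(ltr_pM2l e0); lra.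
have [dd dd'] : Num.min d d' <= d /\ Num.min d d' <= d'.
  by rewrite !ge_min !lexx orbT.
have [|a a1 ha] := hf _ x's; first by nra.
have [|b b1 hb] := hg _ y's; first by nra.
exists (T + Q), (a *: x'), (b *: y'); split; split=> //.
- exact: extremalZ.
- exact: extremalZ.
- by rewrite bf_Zl bf_Zr !nrmM a1 b1 !mul1r.
- by rewrite addrC addKr.
Qed.

(** The limit is taken coordinatewise; since all terms vanish off [s], it is finitely supported and
    thus lies in [c0 X]. *)
Lemma extremal_limit s (z : nat -> c0 X) :
  (forall k, extremal s (z k)) ->
  (forall k, nrm (z k.+1 - z k) <= 2^-1 ^+ k) ->
  exists2 z', nrm z' <= 1 & forall k, nrm (z k - z') <= 2 * 2^-1 ^+ k.
Proof.
move=> zs zq.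
have /choice[l hl] i : exists l, forall k, nrm (z k i - l) <= 2 * 1 * 2^-1 ^+ k.
  apply: geometric_cvg => k; rewrite mul1r; apply: le_trans (zq k).
  exact: (nrm_c0_coord (z k.+1 - z k)).
have zl k : nrm (z k - c0_finite s l) <= 2 * 2^-1 ^+ k.
  apply: nrm_c0_le => i.
  have -> : (z k - c0_finite s l) i = z k i - c0_finite s l i by [].
  rewrite c0_finiteE; case: ifP => si.
    by have := hl i k; rewrite mulr1.
  by rewrite (zs k).1 ?si// subrr nrm0 mulr_ge0.
exists (c0_finite s l) => //; rewrite -subr_le0.
apply: (@geometric_le0 _ _ 2) => k.
have := zl k; have := extremal_le1 (zs k); have := nrm_sub (c0_finite s l) (z k).
by rewrite nrmB; lra.
Qed.

Lemma supported_limit s s' (S : nat -> form) G (C : R) :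
  (forall k, supported s s' (S k)) ->
  (forall k, nrm (S k - G) <= C * 2^-1 ^+ k) -> supported s s' G.
Proof.
move=> Ss hG z w; apply/eqP; rewrite -subr_eq0; apply/eqP/nrm_eq0/le_anti.
rewrite nrm_ge0 andbT.
apply: (@geometric_le0 _ _ (2 * C * (nrm z * nrm w))) => k.
have h (z' w' : c0 X) : nrm z' <= nrm z -> nrm w' <= nrm w ->
    nrm ((S k - G) z' w') <= C * (nrm z * nrm w) * 2^-1 ^+ k.
  move=> hz hw; apply: (le_trans (bf_le _ _ _)).
  rewrite -mulrA [leRHS]mulrAC.
  by rewrite ler_pM ?nrm_ge0 ?mulr_ge0 ?nrm_ge0// ler_pM ?nrm_ge0.
have -> : G (restrict (mem s) z) (restrict (mem s') w) - G z w =
    (S k - G) z w - (S k - G) (restrict (mem s) z) (restrict (mem s') w).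
  by rewrite !bf_subE Ss; ring.
apply: (le_trans (nrmBD _ _)).
have h1 := h z w (lexx _) (lexx _).
have h2 := h _ _ (restrict_le (mem s) z) (restrict_le (mem s') w).
rewrite (_ : 2 * C * _ * _ = C * (nrm z * nrm w) * 2^-1 ^+ k +
  C * (nrm z * nrm w) * 2^-1 ^+ k); first exact: lerD.
ring.
Qed.

Lemma norm_attained_limit (S : nat -> form) (xs ys : nat -> c0 X) G x y (C : R) :
  (forall k, [/\ nrm (xs k) <= 1, nrm (ys k) <= 1 &
     nrm (S k) - C * 2^-1 ^+ k <= nrm (S k (xs k) (ys k))]) ->
  (forall k, nrm (S k - G) <= C * 2^-1 ^+ k) ->
  (forall k, nrm (xs k - x) <= 2 * 2^-1 ^+ k) ->
  (forall k, nrm (ys k - y) <= 2 * 2^-1 ^+ k) ->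
  nrm x <= 1 -> nrm y <= 1 -> nrm (G x y) = nrm G.
Proof.
move=> hS hG hx hy x1 y1; apply/le_anti; rewrite bf_ball//= -subr_le0.
(* Two multiples of [C] come from exchanging [G] and [S k], one from the near-maximality at stage
   [k], and [4 * nrm G] from moving both points to their limits. *)
apply: (@geometric_le0 _ _ (3 * C + 4 * nrm G)) => k.
have q0 : (0 : R) < 2^-1 ^+ k by rewrite exprn_gt0.
have [] := hS k; have := hx k; have := hy k; have := hG k.
move: (S k) (xs k) (ys k) (2^-1 ^+ k) q0 => {hS hx hy hG xs ys}S xk yk q q0.
move=> hSG hyk hxk xk1 yk1 hS.
have h1 : nrm G <= nrm S + nrm (S - G).
  by have := nrm_sub G S; rewrite nrmB; lra.
have h2 : nrm (S xk yk) <= nrm (G xk yk) + nrm (S - G).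
  have := bf_ball (S - G) xk1 yk1; rewrite bf_subE.
  by have := nrm_sub (S xk yk) (G xk yk); lra.
suff h3 : nrm (G xk yk) <= nrm (G x y) + nrm G * (4 * q).
  by rewrite mulrDl; lra.
have -> : G xk yk = G x y + (G (xk - x) yk + G x (yk - y)).
  by rewrite bf_Dl bf_Dr bf_Nl bf_Nr; ring.
apply: (le_trans (nrmD _ _)); rewrite lerD2l.
apply: (le_trans (nrmD _ _)).
apply: (le_trans (lerD (bf_le G (xk - x) yk) (bf_le G x (yk - y)))).
have -> : nrm G * (4 * q) = nrm G * (2 * q) * 1 + nrm G * 1 * (2 * q) by ring.
by rewrite lerD// !ler_pM ?mulr_ge0 ?nrm_ge0.
Qed.

Lemma norm_attaining_dense s s' T (r : R) :
  uniformly_convex X -> uniformly_smooth X -> (exists u : X, nrm u = 1) ->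
  (0 < size s)%N -> (0 < size s')%N -> supported s s' T -> 0 < r ->
  exists G x y, [/\ supported s s' G, nrm (G - T) <= r & nrm x <= 1] /\
    nrm y <= 1 /\ nrm (G x y) = nrm G.
Proof.
move=> uc sm uX s0 s'0 Ts r0; have [u u1] := uX.
pose q k : R := 2^-1 ^+ k; have q0 k : 0 < q k by rewrite exprn_gt0.
pose e k := r / 2 * q k; have e0 k : 0 < e k by rewrite mulr_gt0//; lra.
pose step_ok k (d : R) := 0 < d /\ forall S x y (m m' : R),
  supported s s' S -> extremal s x -> extremal s' y ->
  nrm S - m < nrm (S x y) -> 0 < m' -> m + m' <= d ->
  exists T' x' y',
    [/\ supported s s' T', extremal s x', extremal s' y' &
        nrm T' - m' < nrm (T' x' y')] /\
    [/\ nrm (T' - S) <= e k, nrm (x' - x) <= q k & nrm (y' - y) <= q k].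
have /choice[d hd] k : exists d, step_ok k d.
  by have [d d0 h] := lindenstrauss_step uc sm uX s0 s'0 (e0 k) (q0 k); exists d.
(* The slack is nonincreasing with [m k <= d k / 2], which gives [m k + m k.+1 <= d k] as the step
   requires; [m k <= e k] makes it vanish in the limit. *)
pose m := fix m k : R := let b := Num.min (d k / 2) (e k) in
  if k is k'.+1 then Num.min (m k') b else b.
have b0 k : 0 < Num.min (d k / 2) (e k).
  by rewrite lt_min e0 andbT; have [dk _] := hd k; lra.
have m0 k : 0 < m k.
  by elim: k => [|k IH]; [exact: b0|rewrite /= lt_min IH; exact: b0].
have mS k : m k.+1 <= m k by rewrite /= ge_min lexx.
have mb k : m k <= Num.min (d k / 2) (e k).
  by case: k => [|k] /=; rewrite // ge_min lexx orbT.
have md k : m k <= d k / 2 by apply: le_trans (mb k) _; rewrite ge_min lexx.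
have me k : m k <= e k by apply: le_trans (mb k) _; rewrite ge_min lexx orbT.
pose inv k (a : form * c0 X * c0 X) := [/\ supported s s' a.1.1,
  extremal s a.1.2, extremal s' a.2 & nrm a.1.1 - m k < nrm (a.1.1 a.1.2 a.2)].
pose close k (a b : form * c0 X * c0 X) := [/\ nrm (b.1.1 - a.1.1) <= e k,
  nrm (b.1.2 - a.1.2) <= q k & nrm (b.2 - a.2) <= q k].
have /choice[F hF] (p : nat * (form * c0 X * c0 X)) :
    exists b, inv p.1 p.2 -> inv p.1.+1 b /\ close p.1 p.2 b.
  (* Where the invariant fails the successor is arbitrary; the triple itself is returned. *)
  case: p => k [[S x] y]; have [I|I] := pselect (inv k (S, x, y)); last first.
    by exists (S, x, y).
  have [I1 I2 I3 I4] := I; have [_ h] := hd k.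
  have [|T' [x' [y' [h1 h2]]]] := h S x y (m k) (m k.+1) I1 I2 I3 I4 (m0 _).
    by have := md k; have := mS k; lra.
  by exists (T', x', y').
have [x0 [y0 [x0s y0s Txy0]]] := near_norm_extremal uX Ts (m0 0%N).
pose a := fix a k := if k is k'.+1 then F (k', a k') else (T, x0, y0).
have aI k : inv k (a k).
  by elim: k => [|k IH]; [split|exact: (hF (k, a k) IH).1].
have aC k : close k (a k) (a k.+1) by exact: (hF (k, a k) (aI k)).2.
have [k|G hG] := @bf_geometric_cvg R X u sm u1 _ _ (fun k => (a k).1.1) (r / 2).
  by have [] := aC k.
have [||x x1 hx] := @extremal_limit s (fun k => (a k).1.2).
- by move=> k; have [] := aI k.
- by move=> k; have [] := aC k.
have [||y y1 hy] := @extremal_limit s' (fun k => (a k).2).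
- by move=> k; have [] := aI k.
- by move=> k; have [] := aC k.
have hG' k : nrm ((a k).1.1 - G) <= r * 2^-1 ^+ k.
  by have := hG k; rewrite (_ : 2 * (r / 2) = r)//; field.
exists G, x, y; split; split=> //.
- by apply: supported_limit hG' => k; have [] := aI k.
- by have := hG' 0%N; rewrite nrmB expr0 mulr1.
apply: norm_attained_limit hG' hx hy x1 y1 => k.
have [_ /extremal_le1 xk1 /extremal_le1 yk1 /ltW hk] := aI k; split=> //.
apply: le_trans hk; rewrite lerD2l lerN2; apply: le_trans (me k) _.
by rewrite /e ler_pM2r ?q0//; lra.
Qed.

End norm_attaining.

(** * The Bishop-Phelps-Bollobas property *)

Section bishop_phelps_bollobas.
Context (R : realType) (X : completeNormedModType R[i]).
Local Notation form := (bilin_form (c0 X) (c0 X)).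
Implicit Types (T S G : form) (s : seq nat) (x y : c0 X).

Lemma bf_coordmap T (F F' : nat -> X -> X) :
  (forall i v, nrm (F i v) <= nrm v) ->
  (forall i v, nrm (F' i v) <= nrm v) ->
  (forall i (a : R[i]) v w, F i (a *: v + w) = a *: F i v + F i w) ->
  (forall i (a : R[i]) v w, F' i (a *: v + w) = a *: F' i v + F' i w) ->
  exists2 S : form, nrm S <= nrm T &
    forall x y, S x y = T (coordmap F x) (coordmap F' y).
Proof.
move=> F1 F'1 Fl F'l.
have {}F1 i v : nrm (F i v) <= 1 * nrm v by rewrite mul1r.
have {}F'1 i v : nrm (F' i v) <= 1 * nrm v by rewrite mul1r.
have b x y : nrm x <= 1 -> nrm y <= 1 ->
    nrm (T (coordmap F x) (coordmap F' y)) <= nrm T.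
  move=> x1 y1; apply: bf_ball; apply: (le_trans (coordmap_le _ ler01 _)) => //;
  by rewrite mul1r.
have [|||S SE] := @bf_mk R _ _ (fun x y => T (coordmap F x) (coordmap F' y)) (nrm T).
- by move=> a x x' y; rewrite (coordmap_linear F1 Fl) bf_linl.
- by move=> a x y y'; rewrite (coordmap_linear F'1 F'l) bf_linr.
- exact: b.
by exists S => //; apply: bf_norm_le => x y x1 y1; rewrite SE; exact: b.
Qed.

(** A null sequence has only finitely many coordinates of norm above [1 - b], and normalising each
    of them moves it by less than [b]. *)
Lemma large_coordinates (b : R) x : 0 < b -> b < 1 -> nrm x <= 1 ->
  exists s x', [/\ forall i, i \notin s -> nrm (x i) <= 1 - b,
    extremal s x' & nrm (restrict (mem s) x - x') <= b].
Proof.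
move=> b0 b1 x1; have [|N hN] := @c0_eventually R X x (1 - b); first by lra.
pose s := [seq i <- iota 0 N | 1 - b < nrm (x i)].
have sE i : (i \in s) = (1 - b < nrm (x i)).
  rewrite mem_filter mem_iota /= add0n; case: ltP => //= h.
  by rewrite ltnNge; apply/negP => /hN; lra.
exists s, (c0_finite s (fun i => (nrm (x i))^-1%:C *: x i)).
have x0 i : i \in s -> x i != 0.
  by rewrite sE => h; apply/eqP => xi0; move: h; rewrite xi0 nrm0; lra.
split; first by move=> i; rewrite sE -leNgt.
  split=> i si; rewrite c0_finiteE ?si ?(negPf si)//.
  by rewrite nrm_unit// x0.
apply: nrm_c0_le => i; set z := c0_finite _ _.
have -> : (restrict (mem s) x - z) i = restrict (mem s) x i - z i by [].
rewrite restrictE /= c0_finiteE; case: ifP => si; last by rewrite subrr nrm0 ltW.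
have -> : x i - (nrm (x i))^-1%:C *: x i =
    (nrm (x i) - 1)%:C *: ((nrm (x i))^-1%:C *: x i).
  by rewrite rmorphB scalerBl nrm_unitK rmorph1 scale1r.
have xi1 : nrm (x i) <= 1 by apply: le_trans x1; exact: nrm_c0_coord.
rewrite nrmZr nrm_unit ?x0// mulr1 ler0_norm; last by lra.
by rewrite sE in si; lra.
Qed.

Lemma finitely_supported_reduction (b : R) : uniformly_smooth X ->
  0 < b -> b <= 1 ->
  exists2 eta : R, 0 < eta & forall T x y,
    nrm T <= 1 -> nrm x <= 1 -> nrm y <= 1 -> 1 - eta < nrm (T x y) ->
    exists S s s' x' y',
      [/\ supported s s' S, nrm S <= 1, nrm (S - T) <= b &
          1 - b < nrm (S x' y')] /\
      [/\ extremal s x', extremal s' y',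
          nrm (restrict (mem s) x - x') <= b &
          nrm (restrict (mem s') y - y') <= b].
Proof.
move=> sm b0 b1; have c0 : 0 < b / 8 by lra.
have [eta eta0 h] := small_mass sm c0 c0.
(* Budget for [S x' y']: [b / 4] for [T x y], [b / 4] for [S - T], and [b / 8] for each of the
   replacements of [x] and [y], in total below [b]. *)
exists (Num.min eta (b / 4)); first by rewrite lt_min eta0; lra.
move=> T x y T1 x1 y1 hT.
have [hT1 hT2] : 1 - eta < nrm (T x y) /\ 1 - b / 4 < nrm (T x y).
  split; apply: le_lt_trans hT; rewrite lerD2l lerN2 ge_min lexx ?orbT//.
have [|s [x' [sx x's x'x]]] := @large_coordinates (b / 8) x c0 _ x1; first by lra.
have [|s' [y' [s'y y's y'y]]] := @large_coordinates (b / 8) y c0 _ y1; first by lra.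
have res_le (t : seq nat) i (v : X) : nrm (if mem t i then v else 0) <= nrm v.
  by case: ifP; rewrite ?nrm0 ?nrm_ge0.
have res_lin (t : seq nat) i (a : R[i]) (v w : X) :
    (if mem t i then a *: v + w else 0) =
    a *: (if mem t i then v else 0) + (if mem t i then w else 0).
  by case: ifP; rewrite // scaler0 addr0.
have [S ST SE] := bf_coordmap T (res_le s) (res_le s') (res_lin s) (res_lin s').
have {}SE z w : S z w = T (restrict (mem s) z) (restrict (mem s') w) := SE z w.
have ST' : nrm (S - T) <= b / 4.
  apply: bf_norm_le => z w z1 w1; rewrite bf_subE SE nrmB.
  have -> : T z w - T (restrict (mem s) z) (restrict (mem s') w) =
      T (restrict (predC (mem s)) z) w +
      T (restrict (mem s) z) (restrict (predC (mem s')) w).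
    rewrite {1}(restrictC (mem s) z) {1}(restrictC (mem s') w) bf_Dl.
    rewrite [T (restrict (mem s) z) _]bf_Dr -(restrictC (mem s') w); ring.
  have [hl _] := h T x y (predC (mem s)) pred0 z w T1 x1 y1 hT1 z1 w1.
  have rz1 := le_trans (restrict_le (mem s) z) z1.
  have [_ hr] := h T x y pred0 (predC (mem s')) _ w T1 x1 y1 hT1 rz1 w1.
  apply: (le_trans (nrmD _ _)); have := hl sx; have := hr s'y; lra.
have xs1 := le_trans (restrict_le (mem s) x) x1.
have ys1 := le_trans (restrict_le (mem s') y) y1.
have S1 : nrm S <= 1 by exact: le_trans T1.
have Ss : supported s s' S.
  by move=> z w; rewrite !SE; congr (T _ _); apply: c0_ext => i;
    rewrite !restrictE; case: (mem _ i).
have ST'' : nrm (S - T) <= b by apply: le_trans ST' _; rewrite ler_pdivrMr//; lra.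
have b8 : b / 8 <= b by rewrite ler_pdivrMr//; lra.
exists S, s, s', x', y'; split; split=> //; try exact: le_trans b8.
have h1 : nrm (T x y) - nrm (S x y) <= b / 4.
  apply: le_trans ST'; rewrite nrmB; apply: le_trans (bf_ball _ x1 y1).
  by rewrite bf_subE nrm_sub.
have -> : S x' y' = S x y - (S (restrict (mem s) x - x') (restrict (mem s') y) +
    S x' (restrict (mem s') y - y')).
  rewrite bf_Dl !bf_Dr !bf_Nl !bf_Nr.
  by rewrite -(Ss x y); ring.
apply: lt_le_trans (nrm_sub _ _).
have := nrmD (S (restrict (mem s) x - x') (restrict (mem s') y))
             (S x' (restrict (mem s') y - y')).
have ball2 z w (a c : R) : nrm z <= a -> nrm w <= c -> nrm (S z w) <= a * c.
  move=> za wc; apply: (le_trans (bf_le _ _ _)).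
  rewrite ler_pM ?mulr_ge0 ?nrm_ge0// -[leRHS]mul1r.
  by rewrite ler_pM ?nrm_ge0.
have := ball2 _ _ _ _ x'x ys1.
have := ball2 _ _ _ _ (extremal_le1 x's) y'y.
rewrite mulr1 mul1r; lra.
Qed.

Lemma supported_size s s' T x y : supported s s' T -> 0 < nrm (T x y) ->
  (0 < size s)%N /\ (0 < size s')%N.
Proof.
have res0 z : restrict (mem [::]) z = 0 by apply: c0_ext => i; rewrite restrictE.
move=> Ts Txy; split; rewrite lt0n; apply/eqP => /size0nil E; move: Txy.
  by rewrite -(supported_l _ _ Ts) E res0 bf_0l nrm0 ltxx.
by rewrite -(supported_r _ _ Ts) E res0 bf_0r nrm0 ltxx.
Qed.

(** [b] is rotated onto the direction of [a]. For [a = S x y] and [b = S x2 y], the midpoint of [x]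
    and a rotated [x2] still almost maximises [S] against [y]. *)
Lemma align (a b : R[i]) (r : R) : r <= nrm a -> r <= nrm b ->
  exists2 c : R[i], nrm c = 1 & r <= nrm (2^-1 * (a + c * b)).
Proof.
move=> ra rb; have [c1 c11 c1a] := phase a; have [c2 c21 c2b] := phase b.
have c10 : c1 != 0 by apply/eqP => c10; move: c11; rewrite c10 nrm0; lra.
exists (c2 / c1); first by rewrite nrmM nrmV c11 c21 invr1 mulr1.
have E : c1 * (a + c2 / c1 * b) = (nrm a + nrm b)%:C.
  by rewrite rmorphD /= -c1a -c2b mulrDr; congr (_ + _); field.
rewrite nrmM nrmV nrm_nat//.
rewrite (_ : nrm (_ + _) = nrm a + nrm b); first by lra.
by rewrite -[LHS]mul1r -c11 -nrmM E nrmR ger0_norm ?addr_ge0 ?nrm_ge0.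
Qed.

(** Here [p], [q1], [q2] stand for the moduli of [S x y], [S x2 y], [S x y2], and [N] for the norm
    of [G]. Comparing the bounds on [N] gives [t q1 q2 > t - 5 b], and [5 b < t eta]. *)
Lemma penalty_estimate (t b eta p q1 q2 N M : R) :
  0 < t -> t <= 1 -> 0 < b -> b <= t * eta / 8 -> 1 - b < p -> p <= 1 ->
  p + t * p ^+ 2 <= M -> M - b <= N -> N <= 1 + t * (q1 * q2) + b ->
  0 <= q1 -> 0 <= q2 -> q1 <= 1 -> q2 <= 1 -> 1 - eta < q1 /\ 1 - eta < q2.
Proof.
move=> t0 t1 b0 bt p1 p2 hM hN hq q10 q20 q11 q21.
have h1 : 1 - 2 * b <= p ^+ 2 by have := sqr_ge0 (1 - p); nra.
have h2 : t * (1 - 2 * b) <= t * p ^+ 2 by rewrite ler_pM2l.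
have h3 : t * b <= b by rewrite ler_piMl// ltW.
have h4 : 1 - eta < q1 * q2 by rewrite -(ltr_pM2l t0); lra.
split; apply: (lt_le_trans h4); first by rewrite ler_piMr.
by rewrite ler_piMl.
Qed.

(** Where [x] and [y] are far apart, their midpoint lies well inside the ball, which is what
    [small_mass] asks of a set of coordinates. *)
Lemma midpoint_bound (t d : R) (x y : c0 X) :
  (forall v w : X, nrm v <= 1 -> nrm w <= 1 ->
     t <= nrm (v - w) -> nrm (v + w) <= 2 - d) ->
  nrm x <= 1 -> nrm y <= 1 ->
  nrm (2^-1 *: (x + y)) <= 1 /\
  forall i, t < nrm (y i - x i) -> nrm ((2^-1 *: (x + y)) i) <= 1 - d / 2.
Proof.
move=> hd x1 y1.
have n2 : nrm (2^-1 : R[i]) = 2^-1.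
  by rewrite nrmV nrm_nat.
split=> [|i]; first by rewrite nrmZ n2; have := nrmD x y; lra.
rewrite nrmB => /ltW hi.
have -> : (2^-1 *: (x + y)) i = 2^-1 *: (x i + y i) by [].
have xi : nrm (x i) <= 1 by apply: le_trans x1; exact: nrm_c0_coord.
have yi : nrm (y i) <= 1 by apply: le_trans y1; exact: nrm_c0_coord.
by rewrite nrmZ n2; have := hd _ _ xi yi hi; lra.
Qed.

(* The perturbation [t S(., y) S(x, .)] forces maximisers of the perturbed form
   to satisfy [S(x1, y) ~ 1 ~ S(x, y1)], hence to be close to [x] and [y] except
   where [S] carries little mass. *)
Lemma norm_attaining_near (t : R) :
  uniformly_convex X -> uniformly_smooth X -> (exists u : X, nrm u = 1) ->
  0 < t -> t <= 1 ->
  exists2 b : R, 0 < b & forall s s' S x y, supported s s' S -> nrm S <= 1 ->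
    extremal s x -> extremal s' y -> 1 - b < nrm (S x y) ->
    exists G x1 y1 (D E : pred nat),
      [/\ supported s s' G, nrm (G - S) <= 2 * t, nrm x1 <= 1, nrm y1 <= 1 &
          nrm (G x1 y1) = nrm G] /\
      [/\ forall i, D i -> i \in s, forall i, E i -> i \in s',
        forall i, i \in s -> ~~ D i -> nrm (x1 i - x i) <= t &
        forall i, i \in s' -> ~~ E i -> nrm (y1 i - y i) <= t] /\
      forall z w, nrm z <= 1 -> nrm w <= 1 ->
        nrm (S (restrict D z) w) <= t /\ nrm (S z (restrict E w)) <= t.
Proof.
move=> uc sm uX t0 t1; have [d d0 hd] := uniformly_convex_ball uc t0.
have d2 : 0 < d / 2 by lra.
have [eta eta0 hm] := small_mass sm t0 d2.
have te0 : 0 < t * eta by rewrite mulr_gt0.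
(* The bounds serve, in order, [penalty_estimate], the inequality [1 - eta < nrm (S x y)], and
   [nrm (G - S) <= b + t <= 2 * t]. *)
pose b := Num.min (Num.min (t * eta / 8) (eta / 2)) (t / 2).
have b0 : 0 < b by rewrite !lt_min; apply/andP; split; [apply/andP; split|]; lra.
have [b1 [b2 b3]] : b <= t * eta / 8 /\ b <= eta / 2 /\ b <= t / 2.
  by rewrite /b !ge_min !lexx ?orbT.
exists b => // s s' S x y Ss S1 xs ys hS; move: b b0 b1 b2 b3 hS => b b0 b1 b2 b3 hS.
have x1 := extremal_le1 xs; have y1 := extremal_le1 ys.
have Sle (z w : c0 X) : nrm z <= 1 -> nrm w <= 1 -> nrm (S z w) <= 1.
  by move=> z1 w1; exact: le_trans (bf_ball _ z1 w1) S1.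
have [|s0 s'0] := supported_size (x := x) (y := y) Ss; first by lra.
have [c c1 cS] := phase (S x y).
have contr_l : contractive_functional (fun z => S z y).
  split=> [a z w|z]; first by rewrite bf_linl.
  apply: (le_trans (bf_le _ _ _)); rewrite -[leRHS]mul1r -[leRHS]mulr1.
  by rewrite !ler_pM ?mulr_ge0 ?nrm_ge0.
have contr_r : contractive_functional (fun w => S x w).
  split=> [a z w|w]; first by rewrite bf_linr.
  apply: (le_trans (bf_le _ _ _)); rewrite -[leRHS]mul1r.
  rewrite ler_pM ?mulr_ge0 ?nrm_ge0// -[leRHS]mul1r.
  by rewrite ler_pM ?nrm_ge0.
(* The factor [c] puts [Q x y] in phase with [S x y]: it equals [t |S x y| S x y]. *)
have [Q Qt QE] := rank_one_form (t%:C * c) contr_l contr_r.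
have ntc : nrm (t%:C * c) = t by rewrite nrmM nrmR c1 mulr1 gtr0_norm.
rewrite ntc in Qt.
have SQs : supported s s' (S + Q).
  by move=> z w; rewrite !bf_addE Ss !QE (supported_l _ _ Ss) (supported_r _ _ Ss).
have [G [x2 [y2 [[Gs GSQ x21] [y21 Gxy]]]]] :=
  norm_attaining_dense uc sm uX s0 s'0 SQs b0.
have SQxy : nrm (S x y) + t * nrm (S x y) ^+ 2 <= nrm ((S + Q) x y).
  rewrite bf_addE QE.
  have -> : S x y + t%:C * c * (S x y * S x y) =
      S x y * (1 + t * nrm (S x y))%:C.
    by rewrite rmorphD rmorph1 rmorphM /= -cS; ring.
  have p0 : 0 <= 1 + t * nrm (S x y).
    by rewrite addr_ge0// mulr_ge0 ?nrm_ge0// ltW.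
  by rewrite nrmM nrmR ger0_norm// le_eqVlt; apply/orP; left; apply/eqP; ring.
have low : nrm ((S + Q) x y) - b <= nrm G.
  rewrite lerBlDr; apply: (le_trans (bf_ball (S + Q) x1 y1)).
  have h2 := nrm_sub (S + Q) G; rewrite nrmB in h2.
  by rewrite -lerBlDl; exact: le_trans h2 GSQ.
have up : nrm G <= 1 + t * (nrm (S x2 y) * nrm (S x y2)) + b.
  rewrite -Gxy; have h := bf_ball (G - (S + Q)) x21 y21.
  have -> : G x2 y2 = (G - (S + Q)) x2 y2 + (S + Q) x2 y2 by rewrite bf_subE subrK.
  apply: (le_trans (nrmD _ _)); rewrite addrC lerD ?(le_trans h)//.
  rewrite bf_addE; apply: (le_trans (nrmD _ _)); rewrite lerD ?Sle//.
  by rewrite QE nrmM ntc nrmM.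
have [rx ry] := penalty_estimate t0 t1 b0 b1 hS (Sle _ _ x1 y1) SQxy low up
  (nrm_ge0 _) (nrm_ge0 _) (Sle _ _ x21 y1) (Sle _ _ x1 y21).
pose r := Num.min (Num.min (nrm (S x2 y)) (nrm (S x y2))) (nrm (S x y)).
have rlt : 1 - eta < r.
  rewrite !lt_min rx ry /=; apply: le_lt_trans hS; rewrite lerD2l lerN2.
  by apply: (le_trans b2); rewrite ler_pdivrMr// ler_peMr ?ler1n// ltW.
have [r1 [r2 r3]] : r <= nrm (S x2 y) /\ r <= nrm (S x y2) /\ r <= nrm (S x y).
  by rewrite /r !ge_min !lexx ?orbT.
have [a a1 ha] := align r3 r1; have [a' a'1 ha'] := align r3 r2.
have ax2 : nrm (a *: x2) <= 1 by rewrite nrmZ a1 mul1r.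
have ay2 : nrm (a' *: y2) <= 1 by rewrite nrmZ a'1 mul1r.
have [mx hx] := midpoint_bound hd x1 ax2.
have [my hy] := midpoint_bound hd y1 ay2.
exists G, (a *: x2), (a' *: y2),
  (fun i => (i \in s) && (t < nrm ((a *: x2) i - x i))),
  (fun i => (i \in s') && (t < nrm ((a' *: y2) i - y i))).
split; first split=> //.
- have -> : G - S = G - (S + Q) + Q by rewrite opprD addrA subrK.
  apply: (le_trans (nrmD _ _)); rewrite mulr_natl mulr2n lerD//.
  apply: (le_trans GSQ); apply: (le_trans b3).
  by rewrite ler_pdivrMr// ler_peMr ?ler1n// ltW.
- by rewrite bf_Zl bf_Zr !nrmM a1 a'1 !mul1r.
split; first split.
- by move=> i /andP[].
- by move=> i /andP[].
- by move=> i -> /=; rewrite -leNgt.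
- by move=> i -> /=; rewrite -leNgt.
move=> z w z1 w1; split.
  apply: (hm S (2^-1 *: (x + a *: x2)) y _ pred0 z w S1 mx y1 _ z1 w1).1.
    by apply: lt_le_trans rlt _; rewrite bf_Zl bf_Dl bf_Zl.
  by move=> i /andP[_ hi]; exact: hx.
apply: (hm S x (2^-1 *: (y + a' *: y2)) pred0 _ z w S1 x1 my _ z1 w1).2.
  by apply: lt_le_trans rlt _; rewrite bf_Zr bf_Dr bf_Zr.
by move=> i /andP[_ hi]; exact: hy.
Qed.

(* Moves the point at which the norm is attained: on [D] the map is the rank-one
   contraction sending [u i] to [v i], elsewhere it is the identity. *)
Lemma transfer_map (D : pred nat) (u v : c0 X) : uniformly_smooth X ->
  (forall i, D i -> nrm (u i) = 1) -> nrm v <= 1 ->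
  exists F : nat -> X -> X,
    [/\ forall i z, nrm (F i z) <= nrm z,
        forall i (a : R[i]) z w, F i (a *: z + w) = a *: F i z + F i w,
        forall i, D i -> F i (u i) = v i & forall i z, ~~ D i -> F i z = z].
Proof.
move=> sm Du v1.
have /choice[f hf] i : exists f, contractive_functional f /\
    f (u i) = (nrm (u i))%:C.
  by have [f] := support_functional (u i) sm; exists f.
exists (fun i z => if D i then f i z *: v i else z); split=> [i z|i a z w|i Di|i z].
- case: ifP => // _; rewrite nrmZ -[leRHS]mulr1 ler_pM ?nrm_ge0//.
    exact: (hf i).1.2.
  by apply: le_trans v1; exact: nrm_c0_coord.
- by case: ifP => // _; rewrite (hf i).1.1 scalerDl scalerA.
- by rewrite Di (hf i).2 Du// scale1r.
- by move/negPf ->.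
Qed.

Lemma transfer_point (s : seq nat) (D : pred nat) (x0 x x1 : c0 X) (t b : R) :
  uniformly_smooth X -> extremal s x -> (forall i, D i -> i \in s) ->
  nrm (restrict (mem s) x0 - x) <= b -> nrm x0 <= 1 -> nrm x1 <= 1 -> 0 <= t ->
  (forall i, i \in s -> ~~ D i -> nrm (x1 i - x i) <= t) ->
  exists F u, [/\ forall i z, nrm (F i z) <= nrm z,
    forall i (a : R[i]) z w, F i (a *: z + w) = a *: F i z + F i w,
    forall i z, ~~ D i -> F i z = z &
    restrict (mem s) (coordmap F u) = restrict (mem s) x1] /\
    nrm u <= 1 /\ nrm (u - x0) <= t + b.
Proof.
move=> sm xs Ds hb x01 x11 t0 hD.
(* The new point is [x] on [D], where [F] carries it to [x1]; it is [x1] on the rest of [s] and [x0]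
   off [s], so it stays close to [x0] everywhere. *)
pose w := c0_finite s (fun i => if D i then x i else x1 i).
pose u : c0 X := w + restrict (predC (mem s)) x0.
have uE i : u i = if i \in s then if D i then x i else x1 i else x0 i.
  have -> : u i = w i + restrict (predC (mem s)) x0 i by [].
  by rewrite c0_finiteE restrictE /=; case: ifP; rewrite ?addr0 ?add0r.
have Du i : D i -> nrm (u i) = 1.
  by move=> Di; rewrite uE Ds// Di xs.2// Ds.
have [F [F1 Fl FD FnD]] := transfer_map sm Du x11.
have {}F1' i z : nrm (F i z) <= 1 * nrm z by rewrite mul1r.
exists F, u; split; [split=> //|split].
- apply: c0_ext => i; rewrite !restrictE /=; case: ifP => // si.
  rewrite (coordmapE _ _ F1'); have [Di|nDi] := boolP (D i); first exact: FD.
  by rewrite FnD// uE si (negPf nDi).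
- apply: nrm_c0_le => i; rewrite uE; case: ifP => si; last first.
    by apply: le_trans x01; exact: nrm_c0_coord.
  case: ifP => Di; first by rewrite xs.2.
  by apply: le_trans x11; exact: nrm_c0_coord.
apply: nrm_c0_le => i; have -> : (u - x0) i = u i - x0 i by [].
have b0 : 0 <= b by apply: le_trans hb; exact: nrm_ge0.
rewrite uE; case: ifP => si; last by rewrite subrr nrm0 addr_ge0.
have hbi : nrm (x i - x0 i) <= b.
  rewrite nrmB; apply: le_trans hb; apply: le_trans (nrm_c0_coord _ i).
  have -> : (restrict (mem s) x0 - x) i = restrict (mem s) x0 i - x i by [].
  by rewrite restrictE /= si.
case: ifPn => Di; first by apply: le_trans hbi _; rewrite lerDr.
by apply: (le_trans (nrm_tri _ (x i) _)); rewrite lerD// hD.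
Qed.

(** [F] and [F'] move only coordinates in [D] and [E], where [G] is at most [t + 2 t = 3 t]. The
    difference [S' - G] splits into four such terms, whence [12 * t]. *)
Lemma transfer_form (G S : form) (F F' : nat -> X -> X) (D E : pred nat) (t : R) :
  nrm (G - S) <= 2 * t ->
  (forall i z, nrm (F i z) <= nrm z) ->
  (forall i z, nrm (F' i z) <= nrm z) ->
  (forall i (a : R[i]) z w, F i (a *: z + w) = a *: F i z + F i w) ->
  (forall i (a : R[i]) z w, F' i (a *: z + w) = a *: F' i z + F' i w) ->
  (forall i z, ~~ D i -> F i z = z) -> (forall i z, ~~ E i -> F' i z = z) ->
  (forall z w, nrm z <= 1 -> nrm w <= 1 ->
     nrm (S (restrict D z) w) <= t /\ nrm (S z (restrict E w)) <= t) ->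
  exists S' : form, [/\ nrm S' <= nrm G, nrm (S' - G) <= 12 * t &
    forall x y, S' x y = G (coordmap F x) (coordmap F' y)].
Proof.
move=> GS F1 F'1 Fl F'l FD F'E small.
have [S' S'G S'E] := bf_coordmap G F1 F'1 Fl F'l.
exists S'; split=> //; apply: bf_norm_le => z w z1 w1.
have {}F1 i v : nrm (F i v) <= 1 * nrm v by rewrite mul1r.
have {}F'1 i v : nrm (F' i v) <= 1 * nrm v by rewrite mul1r.
have moved (H : nat -> X -> X) (C : pred nat) x :
    (forall i v, nrm (H i v) <= 1 * nrm v) -> (forall i v, ~~ C i -> H i v = v) ->
    coordmap H x - x = restrict C (coordmap H x) - restrict C x.
  move=> H1 HC; apply: c0_ext => i.
  have -> : (coordmap H x - x) i = coordmap H x i - x i by [].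
  have -> : (restrict C (coordmap H x) - restrict C x) i =
    restrict C (coordmap H x) i - restrict C x i by [].
  rewrite !restrictE; case: ifPn => // Ci.
  by rewrite (coordmapE _ _ H1) HC// !subrr.
have Gsmall x y : nrm x <= 1 -> nrm y <= 1 ->
    nrm (G (restrict D x) y) <= 3 * t /\ nrm (G x (restrict E y)) <= 3 * t.
  move=> x1 y1; have [h1 h2] := small x y x1 y1.
  have rx1 := le_trans (restrict_le D x) x1.
  have ry1 := le_trans (restrict_le E y) y1.
  have := bf_ball (G - S) rx1 y1; have := bf_ball (G - S) x1 ry1.
  rewrite !bf_subE.
  have := nrm_sub (G (restrict D x) y) (S (restrict D x) y).
  have := nrm_sub (G x (restrict E y)) (S x (restrict E y)).
  by move: GS h1 h2; clear; move=> *; split; lra.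
have map1 (H : nat -> X -> X) x : (forall i v, nrm (H i v) <= 1 * nrm v) ->
    nrm x <= 1 -> nrm (coordmap H x) <= 1.
  move=> H1; apply: le_trans; apply: le_trans (coordmap_le _ ler01 H1) _.
  by rewrite mul1r.
have z1' := map1 _ _ F1 z1; have w1' := map1 _ _ F'1 w1.
rewrite bf_subE S'E.
have -> : G (coordmap F z) (coordmap F' w) - G z w =
    G (coordmap F z - z) (coordmap F' w) + G z (coordmap F' w - w).
  by rewrite bf_Dl bf_Dr bf_Nl bf_Nr; ring.
rewrite (moved _ _ _ F1 FD) (moved _ _ _ F'1 F'E).
rewrite bf_Dl bf_Dr bf_Nl bf_Nr.
have [p1 _] := Gsmall _ _ z1' w1'; have [p2 _] := Gsmall _ _ z1 w1'.
have [_ p3] := Gsmall _ _ z1 w1'; have [_ p4] := Gsmall _ _ z1 w1.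
apply: (le_trans (nrmD _ _)).
apply: (le_trans (lerD (nrmBD _ _) (nrmBD _ _))).
by move: p1 p2 p3 p4; lra.
Qed.

(** Dividing by [nrm S] costs [|1 - nrm S| <= r]. The points become unit vectors since
    [1 = nrm (S' u v) <= nrm u * nrm v]. *)
Lemma normalize_form (S T : form) u v (r : R) :
  nrm T = 1 -> nrm (S - T) <= r -> r < 1 -> nrm u <= 1 -> nrm v <= 1 ->
  nrm (S u v) = nrm S ->
  exists S' : form, [/\ nrm S' = 1, nrm (S' u v) = 1, nrm u = 1, nrm v = 1 &
    nrm (S' - T) <= 2 * r].
Proof.
move=> T1 ST r1 u1 v1 Suv.
have h1 := nrm_sub T S; have h2 := nrm_sub S T.
rewrite nrmB in h1.
have S0 : 0 < nrm S by lra.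
have Si : 0 < (nrm S)^-1 by rewrite invr_gt0.
pose S' := (nrm S)^-1%:C *: S.
have S'1 : nrm S' = 1 by rewrite nrmZr gtr0_norm// mulVf// gt_eqF.
have S'uv : nrm (S' u v) = 1.
  by rewrite bf_scaleE nrmM nrmR gtr0_norm// Suv mulVf// gt_eqF.
have := bf_le S' u v; rewrite S'uv S'1 mul1r => huv.
have u0 := nrm_ge0 u; have v0 := nrm_ge0 v.
have ug : 1 <= nrm u by nra.
have vg : 1 <= nrm v by nra.
exists S'; split=> //; [by apply/le_anti; rewrite u1|by apply/le_anti; rewrite v1|].
apply: (le_trans (nrm_tri _ S _)).
have -> : S' - S = ((nrm S)^-1 - 1)%:C *: S.
  by rewrite rmorphB rmorph1 scalerBl scale1r.
have -> : nrm (((nrm S)^-1 - 1)%:C *: S) = `|1 - nrm S|.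
  rewrite nrmZr -{2}(ger0_norm (ltW S0)) -normrM mulrBl mul1r mulVf//.
  by rewrite gt_eqF.
have Sr : `|1 - nrm S| <= r.
  rewrite ler_norml; move: h1 h2 ST; rewrite T1; clear; move=> *.
  by apply/andP; split; lra.
by rewrite mulr_natl mulr2n lerD.
Qed.

End bishop_phelps_bollobas.

Theorem theorem3p2 (R : realType) (X : completeNormedModType R[i]) :
  uniformly_convex X -> uniformly_smooth X -> BPBp_bilinear (c0 X) (c0 X).
Proof.
move=> uc sm eps eps0.
(* Without unit vectors in [X] there are none in [c0 X], and the property is vacuous. *)
have [uX|nuX] := pselect (exists u : X, nrm u = 1); last first.
  exists 1 => // T x0 y0 _ /unit_sphereE x01 _ _; exfalso; apply: nuX.
  have [i xi] : exists i, x0 i != 0.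
    apply: contrapT => h; move: x01.
    have -> : nrm x0 = 0; last by lra.
    apply/le_anti; rewrite nrm_ge0 andbT; apply: nrm_c0_le => i.
    have [->|xi] := eqVneq (x0 i) 0; first by rewrite nrm0.
    by exfalso; apply: h; exists i.
  by exists ((nrm (x0 i))^-1%:C *: x0 i); rewrite nrm_unit.
(* The final errors are [t + b <= 2 t] for the points and, after normalisation,
   [2 (12 t + 2 t + b) <= 30 t] for the form; [15 t < 1] is also required. *)
pose t := Num.min eps 1 / 40.
have t0 : 0 < t by rewrite divr_gt0// lt_min eps0 /=.
have [te t1] : t <= eps / 40 /\ t <= 1 / 40.
  by rewrite /t !ler_pM2r ?invr_gt0// !ge_min !lexx ?orbT.
have t1' : t <= 1 by lra.
have [b0 b00 near] := norm_attaining_near uc sm uX t0 t1'.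
pose b := Num.min b0 t.
have bp : 0 < b by rewrite lt_min b00.
have [bb0 bt] : b <= b0 /\ b <= t by rewrite /b !ge_min !lexx orbT.
have b1 : b <= 1 by lra.
have [eta eta0 reduction] := finitely_supported_reduction sm bp b1.
exists eta => // T x0 y0 /unit_sphereE T1 /unit_sphereE x01 /unit_sphereE y01.
rewrite nrmE ltcR => hT.
have x01' : nrm x0 <= 1 by rewrite x01.
have y01' : nrm y0 <= 1 by rewrite y01.
have T1' : nrm T <= 1 by rewrite T1.
have [S [s [s' [x [y [[Ss S1 ST Sxy] [xs ys hx hy]]]]]]] :=
  reduction T x0 y0 T1' x01' y01' hT.
have Sxy' : 1 - b0 < nrm (S x y).
  by apply: le_lt_trans Sxy; rewrite lerD2l lerN2.
have [G [x1 [y1 [D [E [[Gs GS x11 y11 Gxy] [[Ds Es hD hE] small]]]]]]] :=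
  near s s' S x y Ss S1 xs ys Sxy'.
have [F [u [[F1 Fl FD Fu] [u1 ux0]]]] :=
  transfer_point sm xs Ds hx x01' x11 (ltW t0) hD.
have [F' [v [[F'1 F'l F'E F'v] [v1 vy0]]]] :=
  transfer_point sm ys Es hy y01' y11 (ltW t0) hE.
have [S' [S'G S'GS S'E]] :=
  transfer_form GS F1 F'1 Fl F'l FD F'E small.
(* As [G] depends only on coordinates in [s] and [s'], [S' u v = G x1 y1], whose modulus is
   [nrm G >= nrm S']. *)
have S'uv : nrm (S' u v) = nrm S'.
  apply/le_anti; rewrite bf_ball//=.
  by rewrite S'E -Gs Fu F'v Gs Gxy.
have S'T : nrm (S' - T) <= 15 * t.
  apply: (le_trans (nrm_tri _ G _)).
  apply: (le_trans (lerD S'GS (le_trans (nrm_tri _ S _) (lerD GS ST)))).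
  by move: bt; clear; lra.
have t15 : 15 * t < 1 by move: t1; clear; lra.
have tb : t + b < eps by move: te bt eps0; clear; lra.
have t30 : 2 * (15 * t) < eps by move: te eps0; clear; lra.
have [W [W1 Wuv un vn WT]] := normalize_form T1 S'T t15 u1 v1 S'uv.
exists W, u, v; split; first by split; apply/unit_sphereE.
split; rewrite nrmE ?Wuv// ltcR.
- exact: le_lt_trans tb.
- exact: le_lt_trans tb.
- exact: le_lt_trans t30.
Qed.
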